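(* Let $A$, $B$, $P$ be strings over an integer alphabet (of size polynomial in the input length), with $m = |A|$, $n = |B|$, $r = |P|$. An STR-EC-LCS of $A$ and $B$ excluding $P$ is a string $Z$ of maximum length among all common subsequences of $A$ and $B$ that do not contain $P$ as a substring; let $L$ denote its length, and let $\Sigma$ denote the set of distinct characters that occur in both $A$ and $B$. Then an STR-EC-LCS of $A$ and $B$ excluding $P$ can be computed in $O(n|\Sigma| + (L+1)(m-L+1)r)$ time and space.
   Context: A subsequence of a string $A$ is a string obtained from $A$ by deleting zero or more characters; a substring is a contiguous block of characters. A common subsequence of $A$ and $B$ is a string that is a subsequence of both.
   Formalization: The term n|Σ| is read as n·max(1,|Σ|), since with no common character the literal bound would not even allow reading B (e.g. A = ''a'', P = ''b''); P is assumed non-empty, since every string contains the empty string and no STR-EC-LCS would exist. *)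

(* Defs.v *)
From mathcomp Require Import all_boot.

Set Implicit Arguments.
Unset Strict Implicit.
Unset Printing Implicit Defensive.

Definition excl_common_subseq (A B P Z : seq nat) : bool :=
  [&& subseq Z A, subseq Z B & ~~ infix P Z].

Definition str_ec_lcs (A B P Z : seq nat) : Prop :=
  excl_common_subseq A B P Z /\
  forall Z', excl_common_subseq A B P Z' -> size Z' <= size Z.

Definition common_chars (A B : seq nat) : seq nat :=
  undup [seq x <- A | x \in B].

(* A unit-cost word RAM with structured control flow instead of jumps.  A
   program is a finite text, hence uses finitely many registers; memory is an
   array of words accessed only by Read and Write. *)

Definition reg := nat.

Variant binop := Add | Sub | Mul | Div | Mod | Lt | Eq.

Definition eval_op (o : binop) (x y : nat) : nat :=
  match o with
  | Add => x + y
  | Sub => x - y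
  | Mul => x * y
  | Div => x %/ y
  | Mod => x %% y
  | Lt => x < y
  | Eq => x == y
  end.

Inductive cmd :=
  | Skip
  | Const of reg & nat            (* x := k *)
  | Move of reg & reg             (* x := y *)
  | Op of binop & reg & reg & reg (* x := y o z *)
  | Read of reg & reg             (* x := mem[y] *)
  | Write of reg & reg            (* mem[x] := y *)
  | Seq of cmd & cmd
  | If of reg & cmd & cmd         (* then-branch iff x <> 0 *)
  | While of reg & cmd.           (* loops as long as x <> 0 *)

Record state := State { regs : reg -> nat; mem : nat -> nat }.

Definition upd (f : nat -> nat) (a v : nat) : nat -> nat :=
  fun x => if x == a then v else f x.

Definition set_reg (s : state) (x : reg) (v : nat) : state :=
  State (upd (regs s) x v) (mem s).

Definition set_mem (s : state) (a v : nat) : state :=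
  State (regs s) (upd (mem s) a v).

(* [exec W S p s t s']: on a machine whose words range over 0..W-1 and whose
   memory has the S cells 0..S-1, program p started in s halts in s' after
   exactly t unit-cost steps.  There is no rule for an overflowing result or an
   out-of-range address, so such a computation does not halt successfully. *)
Inductive exec (W S : nat) : cmd -> state -> nat -> state -> Prop :=
  | ExecSkip s :
      exec W S Skip s 1 s
  | ExecConst x k s :
      k < W -> exec W S (Const x k) s 1 (set_reg s x k)
  | ExecMove x y s :
      regs s y < W -> exec W S (Move x y) s 1 (set_reg s x (regs s y))
  | ExecOp o x y z s :
      eval_op o (regs s y) (regs s z) < W ->
      exec W S (Op o x y z) s 1
        (set_reg s x (eval_op o (regs s y) (regs s z)))
  | ExecRead x y s :
      regs s y < S -> mem s (regs s y) < W ->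
      exec W S (Read x y) s 1 (set_reg s x (mem s (regs s y)))
  | ExecWrite x y s :
      regs s x < S -> regs s y < W ->
      exec W S (Write x y) s 1 (set_mem s (regs s x) (regs s y))
  | ExecSeq p q s1 s2 s3 t u :
      exec W S p s1 t s2 -> exec W S q s2 u s3 ->
      exec W S (Seq p q) s1 (t + u) s3
  | ExecIfT x p q s s' t :
      regs s x != 0 -> exec W S p s t s' -> exec W S (If x p q) s t.+1 s'
  | ExecIfF x p q s s' t :
      regs s x = 0 -> exec W S q s t s' -> exec W S (If x p q) s t.+1 s'
  | ExecWhileF x p s :
      regs s x = 0 -> exec W S (While x p) s 1 s
  | ExecWhileT x p s1 s2 s3 t u :
      regs s1 x != 0 -> exec W S p s1 t s2 -> exec W S (While x p) s2 u s3 ->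
      exec W S (While x p) s1 (t + u).+1 s3.

(* Registers 0, 1, 2 hold |A|, |B|, |P|; memory starts with A, B, P one after
   the other; everything else is 0. *)
Definition input_state (A B P : seq nat) : state :=
  State (nth 0 [:: size A; size B; size P]) (nth 0 (A ++ B ++ P)).

(* The output is left in memory: register 0 holds its length and register 1 the
   address of its first character. *)
Definition outputs (S : nat) (s : state) (Z : seq nat) : Prop :=
  [/\ regs s 0 = size Z,
      regs s 1 + size Z <= S &
      forall i, i < size Z -> mem s (regs s 1 + i) = nth 0 Z i].

(* The input and output cells count towards the space S. *)
Definition computes_within (W T S : nat) (p : cmd) (A B P Z : seq nat) : Prop :=
  size (A ++ B ++ P) <= S /\
  exists t s,
    [/\ exec W S p (input_state A B P) t s, t <= T & outputs S s Z].

(* n|Sigma| + (L+1)(m-L+1)r.  The factor |Sigma| is read as max(1,|Sigma|): if A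
   and B share no character, then detecting this takes the time to read B, which
   the literal expression (m+1)r does not account for. *)
Definition ec_lcs_bound (A B P : seq nat) (L : nat) : nat :=
  size B * maxn 1 (size (common_chars A B)) +
  (L + 1) * (size A - L + 1) * size P.

(* Main.v *)
Require Import Defs.
From mathcomp Require Import all_boot zify.

Set Implicit Arguments.
Unset Strict Implicit.
Unset Printing Implicit Defensive.

(**
  Let [m], [n], [r] be the lengths of [A], [B], [P].  For [s <= i <= m] and
  [k < r] let [d(i, s, k)] be the least [j] such that the prefixes of length [i]
  of [A] and [j] of [B] have a common subsequence of length [s] that avoids [P]
  and is in state [k] of the automaton matching [P].  A string of length [s + 1]
  either does not use the last character of the prefix of [A], or extends a
  string of length [s] by it, greedily at its next occurrence in [B]; so
  [d(i + 1, s + 1, .)] is obtained from [d(i, s + 1, .)] and [d(i, s, .)] in time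
  [O(r)].  Filling the table by diagonals [i - s = 0, 1, 2, ...], each one only up
  to its first all-infinite row, the first diagonal that reaches [i = m] is
  [m - L], and no diagonal has more than [L + 1] rows to be computed: this is the
  term [(L+1)(m-L+1)r].  One array indexed by [(s, k)] is updated in place, and
  every improvement allocates a list node (character, parent), so the optimal
  string is read off a linked list.

  The automaton has one column per position of [A] and is built row by row, in
  time [O(mr)].  The table of next occurrences has one column per common
  character, which takes [O(n|Sigma|)] once these are numbered.  To number them,
  characters are renamed in linear time, digit by digit in base [N + 1]: the pairs
  (current name, next digit) are grouped by name in linked lists, and within each
  group an array indexed by digits and stamped with the group gives the new names.
*)

(** * Automaton, subsequences and next occurrences *)

Section Matching.
Variable P : seq nat.
Implicit Types (Z : seq nat) (a : nat).

Definition border Z : nat :=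
  \max_(k < (size P).+1 | suffix (take k P) Z) k.

Lemma border_leq Z : border Z <= size P.
Proof. by apply/bigmax_leqP => k _; rewrite -ltnS. Qed.

Lemma border_max Z k : k <= size P -> suffix (take k P) Z -> k <= border Z.
Proof.
move=> lek sk; have ltk : k < (size P).+1 by [].
exact: (@leq_bigmax_cond _ (fun i : 'I_(size P).+1 => suffix (take i P) Z)
  (fun i => nat_of_ord i) (Ordinal ltk)).
Qed.

Lemma border_suffix Z : suffix (take (border Z) P) Z.
Proof.
rewrite /border.
have [i si ->] := @eq_bigmax_cond _ (fun i : 'I_(size P).+1 => suffix (take i P) Z)
  (fun i => nat_of_ord i) ltac:(by apply/card_gt0P; exists ord0;
    rewrite unfold_in take0 suffix0s).
exact: si.
Qed.

Lemma border_size Z : border Z <= size Z.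
Proof.
by have:= size_suffix (border_suffix Z); rewrite size_takel // border_leq.
Qed.

Lemma border_nil : border [::] = 0.
Proof. by apply/eqP; rewrite -leqn0; apply: border_size. Qed.

Lemma suffix_of_suffixes Z u v :
  suffix u Z -> suffix v Z -> size u <= size v -> suffix u v.
Proof.
move=> /suffixP[u' E] /suffixP[v' E'] le.
have sz : size u' + size u = size v' + size v by rewrite -!size_cat -E -E'.
suff -> : u = drop (size u' - size v') v by apply: suffix_drop.
have := congr1 (drop (size u')) E; rewrite drop_size_cat // => <-.
rewrite E' drop_cat ifN //; lia.
Qed.

Lemma suffix_take_rcons j Z a : 0 < j <= size P ->
  suffix (take j P) (rcons Z a) =
  (nth 0 P j.-1 == a) && suffix (take j.-1 P) Z.
Proof.
case: j => // j /= lej.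
by rewrite (take_nth 0) // suffix_rcons.
Qed.

Lemma border_rcons Z a :
  border (rcons Z a) = border (rcons (take (border Z) P) a).
Proof.
apply/eqP; rewrite eqn_leq; apply/andP; split; apply: border_max;
  rewrite ?border_leq //.
  case: (posnP (border (rcons Z a))) => [->|j0]; first by rewrite take0 suffix0s.
  have:= border_suffix (rcons Z a).
  rewrite !suffix_take_rcons ?j0 ?border_leq // => /andP[-> sj] /=.
  have lej := border_leq (rcons Z a).
  apply: (suffix_of_suffixes sj); first exact: border_suffix.
  have lt : (border (rcons Z a)).-1 <= border Z by apply: border_max sj; lia.
  by rewrite !size_takel ?border_leq //; apply: leq_trans (leq_pred _) lej.
apply: (suffix_trans (border_suffix _)).
by rewrite suffix_rcons eqxx border_suffix.
Qed.

Lemma border_full Z : suffix P Z = (border Z == size P).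
Proof.
apply/idP/eqP => [sP|E].
  by apply/eqP; rewrite eqn_leq border_leq border_max // take_size.
by have:= border_suffix Z; rewrite E take_size.
Qed.

Lemma infix_rcons_border Z a :
  ~~ infix P (rcons Z a) = ~~ infix P Z && (border (rcons Z a) < size P).
Proof.
rewrite infix_rconsl border_full negb_or andbC; congr andb.
by rewrite ltn_neqAle border_leq andbT.
Qed.

Lemma border_excl Z : ~~ infix P Z -> border Z < size P.
Proof.
move=> nP; rewrite ltn_neqAle border_leq andbT -border_full.
by apply: contra nP => /suffixW.
Qed.

Definition step k a : nat := border (rcons (take k P) a).

(* Fallback state of Sedgewick's construction of the matching automaton. *)
Definition fallback k : nat := border (behead (take k P)).

Lemma border_step Z a : border (rcons Z a) = step (border Z) a.
Proof. exact: border_rcons. Qed.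

Lemma step_match k : k < size P -> step k (nth 0 P k) = k.+1.
Proof.
move=> ltk; rewrite /step -take_nth //; apply/eqP; rewrite eqn_leq.
rewrite (leq_trans (border_size _)) ?size_takel //=.
by rewrite border_max // suffix_refl.
Qed.

Lemma step_fallback k a : k < size P -> nth 0 P k != a ->
  step k a = if k == 0 then 0 else step (fallback k) a.
Proof.
move=> ltk ne.
have le: step k a <= k.
  have := border_size (rcons (take k P) a).
  rewrite size_rcons size_takel ?(ltnW ltk) // -/(step k a) leq_eqVlt ltnS.
  case/orP=> // /eqP E.
  have := border_suffix (rcons (take k P) a); rewrite -/(step k a) E.
  by rewrite suffix_take_rcons //= (negPf ne).
case: eqP => [k0|/eqP k0]; first by lia.
rewrite -[RHS]border_rcons.
case E: (take k P) => [|x s].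
  by have := size_takel (ltnW ltk); rewrite E /=; lia.
rewrite /step E /= in le *; apply/eqP; rewrite eqn_leq; apply/andP; split.
  apply: border_max; first exact: border_leq.
  apply: (@suffix_of_suffixes (rcons (x :: s) a)); first exact: border_suffix.
    by rewrite rcons_cons suffix_cons.
  rewrite size_takel ?border_leq // size_rcons.
  by have := size_takel (ltnW ltk); rewrite E /= => ->.
apply: border_max; first exact: border_leq.
apply: suffix_trans (border_suffix _) _.
by rewrite suffix_cons.
Qed.

Lemma fallback1 : fallback 1 = 0.
Proof. by rewrite /fallback; case: P => [|x s] /=; rewrite ?take0 border_nil. Qed.

Lemma fallbackS k : 0 < k < size P ->
  fallback k.+1 = step (fallback k) (nth 0 P k).
Proof.
move=> /andP[k0 ltk]; rewrite -border_step /fallback (take_nth 0) //.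
by case: k k0 ltk => // k _; case: P.
Qed.

End Matching.

Lemma subseq_rcons2 (Z Y : seq nat) a b :
  subseq (rcons Z a) (rcons Y b) =
  if a == b then subseq Z Y else subseq (rcons Z a) Y.
Proof.
rewrite -subseq_rev !rev_rcons /= -rev_rcons.
by case: eqP; rewrite subseq_rev.
Qed.

Lemma subseq_rcons_split (Z Y : seq nat) a j : j <= size Y ->
  subseq (rcons Z a) (take j Y) ->
  exists2 i, i < j & nth 0 Y i = a /\ subseq Z (take i Y).
Proof.
elim: j => [|j IH] lej; first by rewrite take0 subseq0; case: Z.
rewrite (take_nth 0) // subseq_rcons2; case: eqP => [-> sZ|_ sZ].
  by exists j.
have [i lt H] := IH (ltnW lej) sZ.
by exists i => //; apply: ltnW.
Qed.

Lemma subseq_takeW (Z Y : seq nat) i j :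
  i <= j -> subseq Z (take i Y) -> subseq Z (take j Y).
Proof.
move=> le sZ; apply: subseq_trans sZ _.
by rewrite -(minn_idPl le) take_min take_subseq.
Qed.

Lemma subseq_rcons_take (Z Y : seq nat) i j :
  i < j <= size Y -> subseq Z (take i Y) ->
  subseq (rcons Z (nth 0 Y i)) (take j Y).
Proof.
move=> /andP[lt le] sZ; apply: (@subseq_takeW _ _ i.+1) => //.
by rewrite (take_nth 0) ?subseq_rcons2 ?eqxx //; lia.
Qed.

(* A prefix of an embedded string leaves room for the characters that follow. *)
Lemma subseq_take_take (Z Y : seq nat) s e :
  s <= size Z -> subseq Z (take (e + size Z) Y) ->
  subseq (take s Z) (take (e + s) Y).
Proof.
elim/last_ind: Z => [|Z a IH] /=; first by case: s => //; rewrite take0 !sub0seq.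
rewrite size_rcons leq_eqVlt => /orP[/eqP ->|lts].
  by rewrite (@take_oversize _ _ (rcons Z a)) ?size_rcons.
move=> sZ; rewrite -cats1 takel_cat; last by lia.
apply: IH; first by lia.
have: exists2 j, j <= e + size Z & subseq Z (take j Y).
  case: (leqP (size Y) (e + (size Z).+1)) => le.
    rewrite take_oversize // -(take_size Y) in sZ.
    have [i lt [_ si]] := subseq_rcons_split (leqnn _) sZ.
    by exists i => //; lia.
  have [i lt [_ si]] := subseq_rcons_split (ltnW le) sZ.
  by exists i => //; lia.
by case=> j lej; apply: subseq_takeW.
Qed.

Section NextOccurrence.
Variable B : seq nat.
Let n := size B.

(* End of the shortest prefix of [B] that contains [a] at or after position
   [j]; [n + 1] stands for infinity. *)
Definition next_end j a : nat := minn n.+1 (j + index a (drop j B)).+1.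

Lemma next_end_inf j a : n <= j -> next_end j a = n.+1.
Proof. by move=> le; apply/minn_idPl; rewrite ltnS (leq_trans le) ?leq_addr. Qed.

Lemma next_end_rec j a : j < n ->
  next_end j a = if nth 0 B j == a then j.+1 else next_end j.+1 a.
Proof.
move=> ltj; rewrite /next_end (drop_nth 0) //=.
by case: eqP => _; lia.
Qed.

Lemma next_end_absent j a : a \notin B -> next_end j a = n.+1.
Proof.
move=> aB; rewrite /next_end (memNindex _) ?size_drop -/n; first by lia.
by apply: contra aB => /mem_drop.
Qed.

Lemma next_end_min j i : j <= i -> i < n -> next_end j (nth 0 B i) <= i.+1.
Proof.
move=> /subnKC <-; move: (i - j) => t; elim: t j => [|t IH] j lt.
  by rewrite addn0 in lt *; rewrite next_end_rec // eqxx.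
rewrite next_end_rec; last by lia.
by case: ifP => _; [lia | rewrite addnS -addSn; apply: IH; lia].
Qed.

Lemma next_endP j a : next_end j a <= n ->
  [/\ j < next_end j a & nth 0 B (next_end j a).-1 = a].
Proof.
case: (leqP n j) => [le|lt]; first by rewrite next_end_inf // ltnn.
rewrite -(subKn (ltnW lt)); move: (n - j) (leq_subr j n) => t.
elim: t => [|t IH] le; first by rewrite subn0 next_end_inf // ltnn.
rewrite next_end_rec; last by lia.
have -> : (n - t.+1).+1 = n - t by lia.
case: eqP => [E _|_]; first by split; [lia | rewrite -E; congr nth; lia].
by move=> /(IH (ltnW le))[? ->]; split => //; lia.
Qed.

End NextOccurrence.

Lemma next_end_subseq (B Z : seq nat) j a :
  next_end B j a <= size B -> subseq Z (take j B) ->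
  subseq (rcons Z a) (take (next_end B j a) B).
Proof.
move=> le sZ; have [lt E] := next_endP le.
rewrite -[X in rcons Z X]E; apply: subseq_rcons_take; first by lia.
by apply: subseq_takeW sZ; lia.
Qed.

(** * A structured language with arrays on top of the word RAM *)

Inductive expr :=
  | Var of nat
  | Cst of nat
  | Bin of binop & expr & expr
  | Ld of nat & expr.

Inductive stmt :=
  | Nop
  | Asg of nat & expr
  | Sto of nat & expr & expr
  | Sq of stmt & stmt
  | Ite of expr & stmt & stmt
  | Loop of expr & stmt.

Declare Scope prog_scope.
Delimit Scope prog_scope with prog.
Bind Scope prog_scope with stmt.
Local Notation "p ;; q" := (Sq p q)
  (at level 90, right associativity, only parsing) : prog_scope.

Record hst := HSt { hv : nat -> nat; ha : nat -> nat -> nat }.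

Local Arguments upd f a v x /.

Definition setv (s : hst) x v := HSt (upd (hv s) x v) (ha s).

Definition seta (s : hst) a i v :=
  HSt (hv s) (fun b => if b == a then upd (ha s a) i v else ha s b).

Local Arguments setv s x v /.
Local Arguments seta s a i v /.

(* Array [raw] is the input region [0..N-1]; cell [i] of array [a < 16] has
   address [N + 16 * i + a], so that distinct arrays never overlap although
   their lengths are not known in advance. *)
Local Notation raw := 16 (only parsing).

(* Register 3 holds [N] throughout; registers from 50 on are scratch. *)
Local Notation regN := 3 (only parsing).
Local Notation tmp := 50 (only parsing).

Fixpoint ev (s : hst) (e : expr) : nat :=
  match e with
  | Var x => hv s x
  | Cst k => k
  | Bin o e1 e2 => eval_op o (ev s e1) (ev s e2)
  | Ld a e1 => ha s a (ev s e1)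
  end.

Fixpoint wfE (e : expr) : bool :=
  match e with
  | Var x => x < tmp
  | Cst k => k < 100
  | Bin o e1 e2 => wfE e1 && wfE e2
  | Ld a e1 => (a <= raw) && wfE e1
  end.

Fixpoint wfS (p : stmt) : bool :=
  match p with
  | Nop => true
  | Asg x e => [&& x < tmp, x != regN & wfE e]
  | Sto a e1 e2 => [&& a <= raw, wfE e1 & wfE e2]
  | Sq p q => wfS p && wfS q
  | Ite e p q => [&& wfE e, wfS p & wfS q]
  | Loop e p => wfE e && wfS p
  end.

Definition acost (a : nat) : nat := if a == raw then 1 else 5.

Fixpoint ecost (e : expr) : nat :=
  match e with
  | Var _ | Cst _ => 1
  | Bin o e1 e2 => ecost e1 + (ecost e2 + 1)
  | Ld a e1 => ecost e1 + (acost a + 1)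
  end.

Definition addr (d a : nat) : cmd :=
  if a == raw then Skip
  else Seq (Const (tmp + d.+1) 16)
      (Seq (Op Mul (tmp + d) (tmp + d) (tmp + d.+1))
      (Seq (Op Add (tmp + d) (tmp + d) regN)
      (Seq (Const (tmp + d.+1) a)
           (Op Add (tmp + d) (tmp + d) (tmp + d.+1))))).

Fixpoint compE (d : nat) (e : expr) : cmd :=
  match e with
  | Var x => Move (tmp + d) x
  | Cst k => Const (tmp + d) k
  | Bin o e1 e2 =>
      Seq (compE d e1)
     (Seq (compE d.+1 e2) (Op o (tmp + d) (tmp + d) (tmp + d.+1)))
  | Ld a e1 => Seq (compE d e1) (Seq (addr d a) (Read (tmp + d) (tmp + d)))
  end.

Fixpoint compS (p : stmt) : cmd :=
  match p with
  | Nop => Skip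
  | Asg x e => Seq (compE 0 e) (Move x (tmp + 0))
  | Sto a e1 e2 =>
      Seq (compE 0 e1)
     (Seq (addr 0 a) (Seq (compE 1 e2) (Write (tmp + 0) (tmp + 1))))
  | Sq p q => Seq (compS p) (compS q)
  | Ite e p q => Seq (compE 0 e) (If (tmp + 0) (compS p) (compS q))
  | Loop e p =>
      Seq (compE 0 e) (While (tmp + 0) (Seq (compS p) (compE 0 e)))
  end.

Fixpoint wv (p : stmt) : seq nat :=
  match p with
  | Asg x _ => [:: x]
  | Sq p q | Ite _ p q => wv p ++ wv q
  | Loop _ p => wv p
  | _ => [::]
  end.

Fixpoint wa (p : stmt) : seq nat :=
  match p with
  | Sto a _ _ => [:: a]
  | Sq p q | Ite _ p q => wa p ++ wa q
  | Loop _ p => wa p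
  | _ => [::]
  end.

(* Time of loop-free statements only: the clause for [Loop] is a dummy. *)
Fixpoint scost (p : stmt) : nat :=
  match p with
  | Nop => 1
  | Asg _ e => ecost e + 1
  | Sto a e1 e2 => ecost e1 + (acost a + (ecost e2 + 1))
  | Sq p q => scost p + scost q
  | Ite e p q => ecost e + (scost p + scost q).+1
  | Loop _ _ => 0
  end.

Definition agree (vs aa : seq nat) (s s' : hst) : Prop :=
  (forall x, x \notin vs -> hv s' x = hv s x) /\
  (forall a, a \notin aa -> ha s' a = ha s a).

Lemma agree_refl vs aa s : agree vs aa s s.
Proof. by split. Qed.

Lemma agree_trans vs1 aa1 vs2 aa2 vs aa s1 s2 s3 :
  agree vs1 aa1 s1 s2 -> agree vs2 aa2 s2 s3 ->
  {subset vs1 <= vs} -> {subset vs2 <= vs} ->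
  {subset aa1 <= aa} -> {subset aa2 <= aa} -> agree vs aa s1 s3.
Proof.
move=> [v1 a1] [v2 a2] sv1 sv2 sa1 sa2; split=> x nx.
  by rewrite v2 ?v1 //; apply: contra nx; [apply: sv1 | apply: sv2].
by rewrite a2 ?a1 //; apply: contra nx; [apply: sa1 | apply: sa2].
Qed.

Section Machine.
Variables N M W : nat.

Definition okop (o : binop) (x y : nat) : Prop :=
  match o with
  | Add => x + y < W
  | Mul => x * y < W
  | _ => True
  end.

Definition okix (a i : nat) : Prop := if a == raw then i < N else i < M.

Fixpoint okE (s : hst) (e : expr) : Prop :=
  match e with
  | Var _ | Cst _ => True
  | Bin o e1 e2 => [/\ okE s e1, okE s e2 & okop o (ev s e1) (ev s e2)]
  | Ld a e1 => okE s e1 /\ okix a (ev s e1)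
  end.

Inductive hexec : stmt -> hst -> nat -> hst -> Prop :=
  | HNop s : hexec Nop s 1 s
  | HAsg x e s : okE s e ->
      hexec (Asg x e) s (ecost e + 1) (setv s x (ev s e))
  | HSto a e1 e2 s : okE s e1 -> okE s e2 -> okix a (ev s e1) ->
      hexec (Sto a e1 e2) s (ecost e1 + (acost a + (ecost e2 + 1)))
        (seta s a (ev s e1) (ev s e2))
  | HSq p q s1 s2 s3 t u : hexec p s1 t s2 -> hexec q s2 u s3 ->
      hexec (Sq p q) s1 (t + u) s3
  | HIteT e p q s s' t : okE s e -> ev s e != 0 -> hexec p s t s' ->
      hexec (Ite e p q) s (ecost e + t.+1) s'
  | HIteF e p q s s' t : okE s e -> ev s e = 0 -> hexec q s t s' ->
      hexec (Ite e p q) s (ecost e + t.+1) s'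
  | HLoopF e p s : okE s e -> ev s e = 0 ->
      hexec (Loop e p) s (ecost e + 1) s
  | HLoopT e p s1 s2 s3 t u : okE s1 e -> ev s1 e != 0 ->
      hexec p s1 t s2 -> hexec (Loop e p) s2 u s3 ->
      hexec (Loop e p) s1 (ecost e + (t + u).+1) s3.

Lemma hexec_agree p s t s' : hexec p s t s' -> agree (wv p) (wa p) s s'.
Proof.
elim=> {p s t s'} /=.
- by move=> *; apply: agree_refl.
- move=> x e s _; split=> //= y; rewrite inE.
  by case: eqP.
- move=> a e1 e2 s _ _ _; split=> //= b; rewrite inE.
  by case: eqP.
- move=> p q s1 s2 s3 t u _ A1 _ A2; apply: (agree_trans A1 A2) => x;
  by rewrite mem_cat => ->; rewrite ?orbT.
- move=> e p q s s' t _ _ _ A; apply: (agree_trans A (agree_refl [::] [::] s'));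
  by move=> x //; rewrite mem_cat => ->.
- move=> e p q s s' t _ _ _ A; apply: (agree_trans A (agree_refl [::] [::] s'));
  by move=> x //; rewrite mem_cat => ->; rewrite orbT.
- by move=> *; apply: agree_refl.
- by move=> e p s1 s2 s3 t u _ _ _ A1 _ A2; apply: (agree_trans A1 A2).
Qed.

Variable S : nat.
Hypothesis S_large : N + 16 * M <= S.
Hypothesis W_large : S <= W.
Hypothesis W_const : 100 <= W.

Definition models (l : state) (s : hst) : Prop :=
  [/\ forall x, x < tmp -> regs l x = hv s x,
      regs l regN = N,
      forall i, i < N -> Defs.mem l i = ha s raw i,
      forall a i, a < 16 -> Defs.mem l (N + 16 * i + a) = ha s a i
    & (forall x, regs l x < W) /\ (forall i, Defs.mem l i < W)].

Lemma models_set_tmp l s d v : models l s -> v < W -> models (set_reg l (tmp + d) v) s.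
Proof.
move=> [Hr HN Hi Ha [Hx Hm]] vW; split=> //=.
  by move=> x lx; rewrite ifN ?Hr //; apply/eqP; lia.
by split=> // x; case: ifP.
Qed.

Lemma addr_run d a l s i : models l s -> a <= raw -> okix a i ->
  regs l (tmp + d) = i ->
  exists l', [/\ exec W S (addr d a) l (acost a) l', models l' s,
    regs l' (tmp + d) = (if a == raw then i else N + 16 * i + a),
    (if a == raw then i else N + 16 * i + a) < S &
    forall x, x < tmp + d -> regs l' x = regs l x].
Proof.
move=> R; rewrite /addr /acost /okix leq_eqVlt.
case: eqP => [_ _ iN E|_ /= lta iM E].
  by exists l; split=> //; [apply: ExecSkip | lia].
have lt : N + 16 * i + a < S by lia.
have RN : regs l regN = N by case: R.
set l1 := set_reg l (tmp + d.+1) 16.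
set l2 := set_reg l1 (tmp + d) (16 * i).
set l3 := set_reg l2 (tmp + d) (16 * i + N).
set l4 := set_reg l3 (tmp + d.+1) a.
set l5 := set_reg l4 (tmp + d) (16 * i + N + a).
have E1 : (tmp + d == tmp + d.+1) = false by apply/eqP; lia.
have E2 : (tmp + d.+1 == tmp + d) = false by apply/eqP; lia.
exists l5; split.
- rewrite -[5]/(1 + (1 + (1 + (1 + 1)))).
  apply: ExecSeq; first by apply: ExecConst; lia.
  apply: (ExecSeq (s2 := l2)).
    have -> : l2 = set_reg l1 (tmp + d) (eval_op Mul (regs l1 (tmp + d)) (regs l1 (tmp
        + d.+1))).
      by rewrite /l2 /= eqxx E1 E mulnC.
    by apply: ExecOp; rewrite /= eqxx E1 E; lia.
  apply: (ExecSeq (s2 := l3)).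
    have -> : l3 = set_reg l2 (tmp + d) (eval_op Add (regs l2 (tmp + d)) (regs l2
        regN)).
      by rewrite /l3 /= eqxx RN.
    by apply: ExecOp; rewrite /= eqxx RN; lia.
  apply: (ExecSeq (s2 := l4)); first by apply: ExecConst; lia.
  have -> : l5 = set_reg l4 (tmp + d) (eval_op Add (regs l4 (tmp + d)) (regs l4 (tmp +
      d.+1))).
    by rewrite /l5 /= !eqxx E1.
  by apply: ExecOp; rewrite /= !eqxx E1; lia.
- by do 5! [apply: models_set_tmp => //; try lia].
- by rewrite /= eqxx; lia.
- by [].
- move=> x lx /=.
  by have [-> ->] : (x == tmp + d) = false /\ (x == tmp + d.+1) = false
    by split; apply/eqP; lia.
Qed.

Lemma eval_op_lt o x y : x < W -> okop o x y -> eval_op o x y < W.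
Proof.
case: o => //= xW _.
- by lia.
- exact: leq_ltn_trans (leq_div _ _) xW.
- exact: leq_ltn_trans (leq_mod _ _) xW.
- by apply: leq_ltn_trans (leq_b1 _) _; lia.
- by apply: leq_ltn_trans (leq_b1 _) _; lia.
Qed.

Lemma compE_run e d l s : models l s -> wfE e -> okE s e ->
  exists l', [/\ exec W S (compE d e) l (ecost e) l', models l' s,
    regs l' (tmp + d) = ev s e &
    forall x, x < tmp + d -> regs l' x = regs l x].
Proof.
elim: e d l => [x|k|o e1 IH1 e2 IH2|a e IH] d l R /=.
- move=> lx _; exists (set_reg l (tmp + d) (regs l x)).
  have [Hr _ _ _ [Hx _]] := R.
  split; [exact: ExecMove | exact: models_set_tmp | by rewrite /= eqxx Hr |].
  by move=> y ly; rewrite /= ifN //; apply/eqP; lia.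
- move=> lk _; exists (set_reg l (tmp + d) k).
  split; [apply: ExecConst; lia | apply: models_set_tmp => //;
      lia | by rewrite /= eqxx |].
  by move=> y ly; rewrite /= ifN //; apply/eqP; lia.
- move=> /andP[w1 w2] [o1 o2 oo].
  have [l1 [X1 R1 E1 F1]] := IH1 d l R w1 o1.
  have [l2 [X2 R2 E2 F2]] := IH2 d.+1 l1 R1 w2 o2.
  have E1' : regs l2 (tmp + d) = ev s e1 by rewrite F2 ?E1 //; lia.
  have lt : eval_op o (ev s e1) (ev s e2) < W.
    by apply: eval_op_lt => //; rewrite -E1; case: R1 => _ _ _ _ [].
  exists (set_reg l2 (tmp + d) (eval_op o (ev s e1) (ev s e2))); split.
  + apply: (ExecSeq X1); apply: (ExecSeq X2); rewrite -{1}E1' -{1}E2.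
    by apply: ExecOp; rewrite E1' E2.
  + exact: models_set_tmp.
  + by rewrite /= eqxx.
  + move=> y ly; rewrite /= ifN; last by apply/eqP; lia.
    by rewrite F2 ?F1 //; lia.
- move=> /andP[la we] [oe oi].
  have [l1 [X1 R1 E1 F1]] := IH d l R we oe.
  have [l2 [X2 R2 E2 lt F2]] := addr_run R1 la oi E1.
  have Hm : Defs.mem l2 (regs l2 (tmp + d)) = ha s a (ev s e).
    case: R2 => _ _ Hi Ha _; rewrite E2; move: la oi; rewrite leq_eqVlt /okix.
    case: eqP => [-> _ /Hi //|_ /= la _]; exact: Ha.
  have hW : ha s a (ev s e) < W by rewrite -Hm; case: R2 => _ _ _ _ [].
  exists (set_reg l2 (tmp + d) (ha s a (ev s e))); split.
  + apply: (ExecSeq X1); apply: (ExecSeq X2); rewrite -{1}Hm.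
    by apply: ExecRead; rewrite ?Hm // E2.
  + exact: models_set_tmp.
  + by rewrite /= eqxx.
  + move=> y ly; rewrite /= ifN; last by apply/eqP; lia.
    by rewrite F2 ?F1 //; lia.
Qed.

Lemma compS_run p s t s' : hexec p s t s' -> wfS p ->
  forall l, models l s -> exists2 l', exec W S (compS p) l t l' & models l' s'.
Proof.
elim=> {p s t s'} /=.
- by move=> s _ l R; exists l => //; apply: ExecSkip.
- move=> x e s oe /and3P[lx xN we] l R.
  have [l1 [X1 R1 E1 F1]] := compE_run 0 R we oe.
  exists (set_reg l1 x (ev s e)).
    by apply: (ExecSeq X1); rewrite -E1; apply: ExecMove; case: R1 => _ _ _ _ [].
  have lt : ev s e < W by rewrite -E1; case: R1 => _ _ _ _ [].
  case: R1 => Hr HN Hi Ha [Hx Hm]; split=> //=.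
  + by move=> y ly; case: eqP => // _; apply: Hr.
  + by rewrite eq_sym (negPf xN).
  + by split=> // y; case: ifP.
- move=> a e1 e2 s o1 o2 oi /and3P[la w1 w2] l R.
  have [l1 [X1 R1 E1 F1]] := compE_run 0 R w1 o1.
  have [l2 [X2 R2 E2 lt F2]] := addr_run R1 la oi E1.
  have [l3 [X3 R3 E3 F3]] := compE_run 1 R2 w2 o2.
  have E2' := F3 (tmp + 0) isT; rewrite E2 in E2'.
  exists (set_mem l3 (regs l3 (tmp + 0)) (regs l3 (tmp + 1))).
    apply: (ExecSeq X1); apply: (ExecSeq X2); apply: (ExecSeq X3).
    by apply: ExecWrite; [rewrite E2' | case: R3 => _ _ _ _ []].
  rewrite E2' E3.
  have ltv : ev s e2 < W by rewrite -E3; case: R3 => _ _ _ _ [].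
  case: R3 => Hr HN Hi Ha [Hx Hm].
  move: la oi E2' lt; rewrite leq_eqVlt /okix;
      case: (a =P raw) => [-> _ iN _ _|na /= la iM _ _].
    split=> //=.
    + by move=> i lti; case: eqP => // _; apply: Hi.
    + move=> b i ltb; rewrite ifN; last by apply/eqP; lia.
      by rewrite ifN; [exact: Ha | apply/eqP; lia].
    + by split=> // j; case: ifP.
  split=> //=.
  + move=> i lti; rewrite ifN; last by apply/eqP; lia.
    by rewrite ifN; [exact: Hi | apply/eqP; lia].
  + move=> b i ltb; case: eqP => [E|NE].
      have [-> ->] : b = a /\ i = ev s e1 by lia.
      by rewrite eqxx /upd eqxx.
    case: (b =P a) => [E|_]; last exact: Ha.
    by rewrite E /upd ifN; [apply: Ha | apply/eqP => Ei; apply: NE; rewrite E Ei].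
  + by split=> // j; case: ifP.
- move=> p q s1 s2 s3 t u _ IH1 _ IH2 /andP[wp wq] l R.
  have [l1 X1 R1] := IH1 wp l R; have [l2 X2 R2] := IH2 wq l1 R1.
  by exists l2 => //; apply: ExecSeq X1 X2.
- move=> e p q s s' t oe nz _ IH /and3P[we wp wq] l R.
  have [l1 [X1 R1 E1 F1]] := compE_run 0 R we oe.
  have [l2 X2 R2] := IH wp l1 R1.
  by exists l2 => //; apply: (ExecSeq X1); apply: ExecIfT; rewrite ?E1.
- move=> e p q s s' t oe z _ IH /and3P[we wp wq] l R.
  have [l1 [X1 R1 E1 F1]] := compE_run 0 R we oe.
  have [l2 X2 R2] := IH wq l1 R1.
  by exists l2 => //; apply: (ExecSeq X1); apply: ExecIfF; rewrite ?E1.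
- move=> e p s oe z /andP[we wp] l R.
  have [l1 [X1 R1 E1 F1]] := compE_run 0 R we oe.
  by exists l1 => //; apply: (ExecSeq X1); apply: ExecWhileF; rewrite E1.
- move=> e p s1 s2 s3 t u oe nz _ IH1 _ IH2 /andP[we wp] l R.
  have [l1 [X1 R1 E1 F1]] := compE_run 0 R we oe.
  have [l2 X2 R2] := IH1 wp l1 R1.
  have [l3 X3 R3] := IH2 (introT andP (conj we wp)) l2 R2.
  exists l3 => //; apply: (ExecSeq X1).
  inversion X3 as [| | | | | |p' q' l2' l4 l3' t1 u1 Y1 Y2| | | |]; subst.
  rewrite addnA; apply: ExecWhileT Y2; first by rewrite E1.
  exact: ExecSeq X2 Y1.
Qed.

End Machine.

Section Rules.
Variables N M W : nat.
Notation okE := (okE N M W).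
Notation okix := (okix N M).
Notation hexec := (hexec N M W).

Definition runs (p : stmt) (s : hst) (T : nat) (Q : hst -> Prop) : Prop :=
  exists t s', [/\ hexec p s t s', t <= T & Q s'].

Lemma runs_weaken p s T T' (Q Q' : hst -> Prop) :
  runs p s T Q -> T <= T' ->
  (forall s', agree (wv p) (wa p) s s' -> Q s' -> Q' s') -> runs p s T' Q'.
Proof.
move=> [t [s' [X le q]]] leT QQ; exists t, s'; split=> //; first by lia.
exact: QQ (hexec_agree X) q.
Qed.

Lemma runs_nop s (Q : hst -> Prop) : Q s -> runs Nop s (scost Nop) Q.
Proof. by move=> q; exists 1, s; split=> //; apply: HNop. Qed.

Lemma runs_asg x e s (Q : hst -> Prop) :
  okE s e -> Q (setv s x (ev s e)) -> runs (Asg x e) s (scost (Asg x e)) Q.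
Proof. by move=> oe q; do 2! eexists; split; [apply: HAsg | |]. Qed.

Lemma runs_sto a e1 e2 s (Q : hst -> Prop) :
  okE s e1 -> okE s e2 -> okix a (ev s e1) ->
  Q (seta s a (ev s e1) (ev s e2)) ->
  runs (Sto a e1 e2) s (scost (Sto a e1 e2)) Q.
Proof. by move=> o1 o2 oi q; do 2! eexists; split; [apply: HSto | |]. Qed.

Lemma runs_sq p q s T1 T2 (Q : hst -> Prop) :
  runs p s T1 (fun s' => agree (wv p) (wa p) s s' -> runs q s' T2 Q) ->
  runs (Sq p q) s (T1 + T2) Q.
Proof.
move=> [t [s' [X le H]]].
have [u [s'' [Y le' q']]] := H (hexec_agree X).
by exists (t + u), s''; split=> //; [apply: HSq X Y | lia].
Qed.

Lemma runs_then p q s (Q : hst -> Prop) :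
  runs p s (scost p) (fun s' => runs q s' (scost q) Q) ->
  runs (Sq p q) s (scost (Sq p q)) Q.
Proof.
by move=> H; apply: runs_sq; apply: (runs_weaken H).
Qed.

Lemma runs_ite e p q s (Q : hst -> Prop) : okE s e ->
  (ev s e != 0 -> runs p s (scost p) Q) ->
  (ev s e = 0 -> runs q s (scost q) Q) ->
  runs (Ite e p q) s (scost (Ite e p q)) Q.
Proof.
move=> oe Hp Hq; case: (eqVneq (ev s e) 0) => E.
  have [t [s' [X le q']]] := Hq E.
  by exists (ecost e + t.+1), s'; split=> //=; [apply: HIteF | lia].
have [t [s' [X le q']]] := Hp E.
by exists (ecost e + t.+1), s'; split=> //=; [apply: HIteT | lia].
Qed.

(* [I k] holds in states from which at most [k] iterations remain. *)
Lemma runs_loop (I : nat -> hst -> Prop) k Tb e p s (Q : hst -> Prop) :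
  I k s ->
  (forall k' s', I k' s' -> agree (wv p) (wa p) s s' -> okE s' e) ->
  (forall k' s', I k' s' -> agree (wv p) (wa p) s s' -> ev s' e != 0 ->
     runs p s' Tb (fun s'' => agree (wv p) (wa p) s s'' ->
       exists2 k'', k'' < k' & I k'' s'')) ->
  (forall k' s', I k' s' -> agree (wv p) (wa p) s s' -> ev s' e = 0 -> Q s') ->
  runs (Loop e p) s (k * (Tb + ecost e).+1 + (ecost e + 1)) Q.
Proof.
move=> I0 ok body fin.
suff H : forall j k s', k <= j -> I k s' -> agree (wv p) (wa p) s s' ->
  runs (Loop e p) s' (k * (Tb + ecost e).+1 + (ecost e + 1)) Q.
  exact: (H k k s (leqnn k) I0 (agree_refl _ _ s)).
elim=> [|j IH] k' s' lek Ik A; case: (eqVneq (ev s' e) 0) => E.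
- by exists (ecost e + 1), s'; split; [apply: HLoopF; eauto | lia | eauto].
- have [t [s'' [X le [|k'' ltk _]]]] := body _ _ Ik A E; last by lia.
  by apply: (agree_trans A (hexec_agree X)).
- by exists (ecost e + 1), s'; split; [apply: HLoopF; eauto | lia | eauto].
have [t [s'' [X le H]]] := body _ _ Ik A E.
have A' : agree (wv p) (wa p) s s'' by apply: (agree_trans A (hexec_agree X)).
have [k'' ltk Ik'] := H A'.
have [|u [s3 [Y le' q]]] := IH k'' s'' _ Ik' A'; first by lia.
exists (ecost e + (t + u).+1), s3; split=> //.
  by apply: HLoopT X Y => //; eauto.
have : k'' * (Tb + ecost e).+1 <= (k' - 1) * (Tb + ecost e).+1.
  by rewrite leq_mul2r; lia.
rewrite mulnBl mul1n; have : (Tb + ecost e).+1 <= k' * (Tb + ecost e).+1.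
  by rewrite -{1}[(Tb + ecost e).+1]mul1n leq_mul2r; lia.
by lia.
Qed.

Definition For (x y : nat) (p : stmt) : stmt :=
  Sq (Asg x (Cst 0))
     (Loop (Bin Lt (Var x) (Var y)) (Sq p (Asg x (Bin Add (Var x) (Cst 1))))).

Lemma runs_for (I : nat -> hst -> Prop) n Tb x y p s (Q : hst -> Prop) :
  hv s y = n -> n < W -> y \notin x :: wv p -> x \notin wv p ->
  I 0 (setv s x 0) ->
  (forall i s', i < n -> agree (x :: wv p) (wa p) s s' -> hv s' x = i ->
     I i s' -> runs p s' Tb (fun s'' => I i.+1 (setv s'' x i.+1))) ->
  (forall s', agree (x :: wv p) (wa p) s s' -> I n s' -> Q s') ->
  runs (For x y p) s (n * (Tb + 8) + 6) Q.
Proof.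
move=> En nW yw xw I0 body fin.
have Y0 : y != x by move: yw; rewrite inE negb_or => /andP[].
apply: (@runs_weaken _ _ (2 + (n * (Tb + 4 + 3).+1 + 4)) _ Q) => //; last by lia.
apply: runs_sq; apply: runs_asg => //= A0.
pose J k s' := [/\ hv s' x + k = n, agree (x :: wv p) (wa p) s s'
  & I (hv s' x) s'].
have sub : {subset [:: x] <= x :: wv p} by move=> z; rewrite !inE => ->.
have A1 : agree (x :: wv p) (wa p) s (setv s x 0).
  by apply: (agree_trans A0 (agree_refl [::] [::] _)).
apply: (runs_loop (I := J)).
- by split=> //=; rewrite eqxx.
- move=> k s' [E A _] _; split=> //.
- move=> k s' [E A Is] _ /=; rewrite (A.1 y yw) En => lt.
  have {}lt : hv s' x < n by case: ltnP lt.
  apply: runs_sq; apply: runs_weaken (body _ s' lt A erefl Is) (leqnn _) _.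
  move=> s2 A2 I2 _; have Ex : hv s2 x = hv s' x by apply: A2.1.
  apply: runs_asg; first by split=> //=; lia.
  rewrite /= Ex addn1 => A3; exists k.-1; first by lia.
  split; rewrite /= ?eqxx //; first by lia.
  apply: (agree_trans A (vs2 := x :: wv p) (aa2 := wa p)) => //.
  apply: (agree_trans A2 (vs2 := [:: x]) (aa2 := [::])) => //.
  - split=> //= z; rewrite inE => /negPf ->; by [].
  - by move=> z zw; rewrite inE zw orbT.
- move=> k s' [E A Is] _ /=; rewrite (A.1 y yw) En => lt.
  have Ex : hv s' x = n by case: ltnP lt => //; lia.
  by apply: fin => //; rewrite -Ex.
Qed.

End Rules.

Local Arguments scost : simpl never.

(** * Linear-time renaming of the characters *)

Declare Scope expr_scope.
Bind Scope expr_scope with expr.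
Delimit Scope expr_scope with expr.
Local Notation "$ x" := (Var x) (at level 2, x at level 1, format "$ x") : expr_scope.
Local Notation "# k" := (Cst k) (at level 2, k at level 1, format "# k") : expr_scope.
Local Notation "a @[ e ]" := (Ld a e) (at level 2, format "a @[ e ]") : expr_scope.
Local Notation "e1 + e2" := (Bin Add e1 e2) : expr_scope.
Local Notation "e1 - e2" := (Bin Defs.Sub e1 e2) : expr_scope.
Local Notation "e1 * e2" := (Bin Mul e1 e2) : expr_scope.
Local Notation "e1 %/ e2" := (Bin Div e1 e2) : expr_scope.
Local Notation "e1 %% e2" := (Bin Mod e1 e2) : expr_scope.
Local Notation "e1 < e2" := (Bin Lt e1 e2) : expr_scope.
Local Notation "e1 == e2" := (Bin Eq e1 e2) : expr_scope.
Local Notation "x ::= e" := (Asg x e%expr) (at level 80, e at level 75) : prog_scope.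
Local Notation "a @@[ i ] ::= e" := (Sto a i%expr e%expr)
  (at level 80, i at level 75, e at level 75) : prog_scope.

Local Notation rm := 0 (only parsing).
Local Notation rn := 1 (only parsing).
Local Notation rr := 2 (only parsing).
Local Notation rK := 4 (only parsing).
Local Notation rMore := 8 (only parsing).
Local Notation rB := 9 (only parsing).
Local Notation rCur := 10 (only parsing).
Local Notation rFresh := 11 (only parsing).
Local Notation rI := 12 (only parsing).
Local Notation rD := 13 (only parsing).
Local Notation rQ := 14 (only parsing).

(* [aHead] and [aNext] chain the positions that have the same name; links are
   shifted by one so that 0 is the end of a list. *)
Local Notation aRem := 0 (only parsing).
Local Notation aId := 1 (only parsing).
Local Notation aHead := 2 (only parsing).
Local Notation aNext := 3 (only parsing).
Local Notation aStamp := 4 (only parsing).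
Local Notation aVal := 5 (only parsing).

Local Open Scope prog_scope.

Definition clear_bucket : stmt :=
  aHead @@[$rI] ::= #0 ;; aStamp @@[$rI] ::= #0.

Definition link_bucket : stmt :=
  aNext @@[$rI] ::= aHead @[aId @[$rI]] ;;
  aHead @@[aId @[$rI]] ::= $rI + #1.

Definition visit : stmt :=
  rI ::= $rCur - #1 ;;
  rD ::= aRem @[$rI] %% $rK ;;
  rQ ::= aRem @[$rI] %/ $rK ;;
  aRem @@[$rI] ::= $rQ ;;
  Ite $rQ (rMore ::= #1) Nop ;;
  Ite (aStamp @[$rD] == $rB + #1)
    Nop
    (aStamp @@[$rD] ::= $rB + #1 ;;
     aVal @@[$rD] ::= $rFresh ;;
     rFresh ::= $rFresh + #1) ;;
  aId @@[$rI] ::= aVal @[$rD] ;;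
  rCur ::= aNext @[$rI].

Definition next_bucket : stmt :=
  rB ::= $rB + #1 ;; rCur ::= aHead @[$rB].

Definition traverse : stmt :=
  (rB ::= #0 ;; rCur ::= aHead @[#0] ;; rFresh ::= #0) ;;
  Loop ($rB < $regN) (Ite $rCur visit next_bucket).

Definition rename_pass : stmt :=
  rMore ::= #0 ;; For rI rK clear_bucket ;; For rI regN link_bucket ;; traverse.

Definition rename : stmt :=
  For rI regN (aRem @@[$rI] ::= raw @[$rI]) ;;
  rMore ::= #1 ;;
  Loop $rMore rename_pass.

Fixpoint chain (nx : nat -> nat) (h : nat) (l : seq nat) : Prop :=
  match l with
  | [::] => h = 0
  | i :: l' => h = i.+1 /\ chain nx (nx i) l'
  end.

Lemma chain_upd nx h l i v : i \notin l -> chain nx h l -> chain (upd nx i v) h l.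
Proof.
elim: l h => //= j l IH h; rewrite inE negb_or => /andP[ne nl] [-> C].
by split=> //; rewrite eq_sym (negPf ne); apply: IH.
Qed.

Definition bucket (f : nat -> nat) n b := [seq j <- rev (iota 0 n) | f j == b].

Lemma mem_bucket f n b i : (i \in bucket f n b) = (f i == b) && (i < n).
Proof. by rewrite mem_filter mem_rev mem_iota. Qed.

Lemma bucketS f n b :
  bucket f n.+1 b = if f n == b then n :: bucket f n b else bucket f n b.
Proof. by rewrite /bucket -addn1 iotaD rev_cat /= add0n. Qed.

Definition buckets f n b k := flatten [seq bucket f n c | c <- iota b k].

Lemma mem_buckets f n b k i :
  (i \in buckets f n b k) = (b <= f i < b + k) && (i < n).
Proof.
apply/flatten_mapP/andP => [[c]|[lt ltn]].
  by rewrite mem_iota mem_bucket => ? /andP[/eqP ? ?]; split; lia.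
by exists (f i); rewrite ?mem_iota ?mem_bucket ?eqxx.
Qed.

Lemma buckets_uniq f n b k : uniq (buckets f n b k).
Proof.
elim: k b => [|k IH] b //=; rewrite cat_uniq -/(buckets _ _ _ _) IH andbT.
rewrite filter_uniq ?rev_uniq ?iota_uniq //=.
apply/hasPn => i; rewrite mem_buckets mem_bucket.
by case: eqP => //; lia.
Qed.

Lemma size_buckets f n : (forall i, i < n -> f i < n) -> size (buckets f n 0 n) = n.
Proof.
move=> H; rewrite -[RHS](size_iota 0); apply/eqP; rewrite -uniq_size_uniq.
- exact: buckets_uniq.
- exact: iota_uniq.
- move=> i; rewrite mem_buckets mem_iota /= !add0n.
  by case: (ltnP i n) => [/H ->|_]; rewrite ?andbF.
Qed.

Section Rename.
Variables N M W : nat.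
Notation runs := (runs N M W).
Notation K := N.+1.
Hypothesis M_large : K <= M.
Hypothesis W_large : 2 * K <= W.
Hypothesis N_pos : 0 < N.

Lemma clear_runs s : hv s rK = K ->
  runs (For rI rK clear_bucket) s (K * (scost clear_bucket + 8) + 6)
    (fun s' => forall i, i < K -> ha s' aHead i = 0 /\ ha s' aStamp i = 0).
Proof.
move=> EK.
pose I j s' := forall i, i < j -> ha s' aHead i = 0 /\ ha s' aStamp i = 0.
apply: (runs_for (I := I)); rewrite //=; first by lia.
move=> j s' ltj A Ej IH.
apply: runs_then; apply: runs_sto => //=; first by rewrite /okix /=; lia.
apply: runs_sto => //=; first by rewrite /okix /=; lia.
rewrite /I /= Ej => i; rewrite ltnS leq_eqVlt; case: eqP => [->|_ /=]; first by [].
exact: IH.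
Qed.

Lemma link_runs s : hv s regN = N ->
  (forall i, i < N -> ha s aId i < N) -> (forall b, b < K -> ha s aHead b = 0) ->
  runs (For rI regN link_bucket) s (N * (scost link_bucket + 8) + 6)
    (fun s' => forall b, b < K ->
       chain (ha s' aNext) (ha s' aHead b) (bucket (ha s aId) N b)).
Proof.
move=> EN Hid H0.
pose I j s' := forall b, b < K ->
  chain (ha s' aNext) (ha s' aHead b) (bucket (ha s aId) j b).
apply: (runs_for (I := I)); rewrite //=; first by lia.
move=> j s' ltj A Ej IH.
have Eid : ha s' aId = ha s aId by apply: A.2.
have ? := Hid _ ltj.
apply: runs_then; apply: runs_sto; rewrite /= ?Ej ?Eid /okix /=.
- by [].
- by repeat split; lia.
- by lia.
apply: runs_sto; rewrite /= ?Ej ?Eid /okix /=; try by repeat split; lia.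
rewrite /I /= addn1 => b ltb; rewrite bucketS eq_sym.
case: eqP => [E|ne]; last first.
  by apply: chain_upd; [rewrite mem_bucket ltnn andbF | apply: IH].
split=> //; rewrite /= eqxx.
by apply: chain_upd; [rewrite mem_bucket ltnn andbF | rewrite E; apply: IH; lia].
Qed.

Lemma visit_runs s i (q := ha s aRem i %/ K) (d := ha s aRem i %% K) :
  hv s rK = K -> hv s rCur = i.+1 -> i < N -> hv s rB < N -> hv s rFresh < N ->
  runs visit s (scost visit) (fun s' =>
    [/\ hv s' rCur = ha s aNext i,
        hv s' rMore = (if q == 0 then hv s rMore else 1),
        ha s' aRem = upd (ha s aRem) i q
      & if ha s aStamp d == (hv s rB).+1
        then [/\ hv s' rFresh = hv s rFresh, ha s' aStamp = ha s aStamp,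
                 ha s' aVal = ha s aVal
               & ha s' aId = upd (ha s aId) i (ha s aVal d)]
        else [/\ hv s' rFresh = (hv s rFresh).+1,
                 ha s' aStamp = upd (ha s aStamp) d (hv s rB).+1,
                 ha s' aVal = upd (ha s aVal) d (hv s rFresh)
               & ha s' aId = upd (ha s aId) i (hv s rFresh)]]).
Proof.
move=> EK Ec lti ltb ltf.
have ltd : d < K by rewrite ltn_mod.
apply: runs_then; apply: runs_asg => //.
rewrite (_ : ev _ _ = i); last by rewrite /= Ec subn1.
apply: runs_then; apply: runs_asg; first by rewrite /= /okix /=; repeat split; lia.
rewrite (_ : ev _ _ = d); last by rewrite /= EK.
apply: runs_then; apply: runs_asg; first by rewrite /= /okix /=; repeat split; lia.
rewrite (_ : ev _ _ = q); last by rewrite /= EK.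
apply: runs_then; apply: runs_sto; rewrite //= /okix /=; first by lia.
apply: runs_then.
set s1 := HSt _ _.
pose s2 := if q == 0 then s1 else setv s1 rMore 1.
apply: (@runs_weaken _ _ _ _ _ (scost (Ite $rQ%expr (rMore ::= #1) Nop)) _ (fun s' =>
    s' = s2)) => //.
  apply: runs_ite => //= qz; [apply: runs_asg | apply: runs_nop] => //=.
    by rewrite /s2 ifN.
  by rewrite /s2 qz.
move=> _ _ ->.
have Hv x : x != rMore -> hv s2 x = hv s1 x.
  by rewrite /s2; case: ifP => //= _ /negPf ->.
have Ha : ha s2 = ha s1 by rewrite /s2; case: ifP.
have Hm : hv s2 rMore = if q == 0 then hv s rMore else 1.
  by rewrite /s2; case: ifP.
apply: runs_then; apply: runs_ite.
- by rewrite /= /okix ?Ha ?Hm ?Hv //=; repeat split; lia.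
- rewrite /= Ha !Hv //= addn1 => E; apply: runs_nop.
  apply: runs_then; apply: runs_sto; rewrite /= ?Ha ?Hm ?Hv //= /okix /=;
      try by repeat split; lia.
  apply: runs_asg; rewrite /= ?Ha ?Hm ?Hv //= /okix /=; try by repeat split; lia.
  split=> //.
  by move: E; case: ifP.
- rewrite /= Ha !Hv //= addn1 => E.
  apply: runs_then; apply: runs_sto; rewrite /= ?Ha ?Hm ?Hv //= /okix /=;
      try by repeat split; lia.
  apply: runs_then; apply: runs_sto; rewrite /= ?Ha ?Hm ?Hv //= /okix /=;
      try by repeat split; lia.
  apply: runs_asg; rewrite /= ?Ha ?Hm ?Hv //= /okix /=; try by repeat split; lia.
  apply: runs_then; apply: runs_sto; rewrite /= ?Ha ?Hm ?Hv //= /okix /=;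
      try by repeat split; lia.
  apply: runs_asg; rewrite /= ?Ha ?Hm ?Hv //= /okix /=; try by repeat split; lia.
  split=> //.
  by move: E; case: ifP => // _; rewrite eqxx !addn1; split.
Qed.

Section Traverse.
Variables (f rem : nat -> nat).
Hypothesis f_lt : forall i, i < N -> f i < N.
Notation dig i := (rem i %% K).

(* [U] lists the positions that are still to be visited; those of the current
   bucket [b] come first. *)
Record visiting (b fresh more : nat) (l U : seq nat)
    (rem' id' stamp val : nat -> nat) : Prop := {
  vis_b : b <= N;
  vis_U : U = l ++ buckets f N b.+1 (N - b.+1);
  vis_l : forall i, i \in l -> f i = b /\ i < N;
  vis_uniq : uniq U;
  vis_fresh : fresh + size U <= N;
  vis_rem : forall i, i < N -> rem' i = if i \in U then rem i else rem i %/ K;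
  vis_le : forall i, i < N -> i \notin U -> f i <= b;
  vis_stamp : forall d, d < K -> stamp d <= b.+1;
  vis_val : forall i, i < N -> i \notin U -> f i = b ->
    stamp (dig i) = b.+1 /\ val (dig i) = id' i;
  vis_stamped : forall d, d < K -> stamp d = b.+1 ->
    exists i, [/\ i < N, i \notin U, f i = b & dig i = d];
  vis_id : forall i j, i < N -> j < N -> i \notin U -> j \notin U ->
    id' i = id' j <-> f i = f j /\ dig i = dig j;
  vis_id_lt : forall i, i < N -> i \notin U -> id' i < fresh;
  vis_more0 : more = 0 -> forall i, i < N -> i \notin U -> rem i %/ K = 0;
  vis_more : more <> 0 -> exists2 i, i < N & rem i %/ K <> 0 }.

Lemma visiting_next b fresh more rem' id' stamp val U : b < N ->
  visiting b fresh more [::] U rem' id' stamp val ->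
  visiting b.+1 fresh more (bucket f N b.+1) U rem' id' stamp val.
Proof.
move=> ltb [_ EU _ u fr R le st v sd I Il m0 m].
have EU' : U = bucket f N b.+1 ++ buckets f N b.+2 (N - b.+2).
  rewrite EU /=; case: (ltnP b.+1 N) => lt.
    by have -> : N - b.+1 = (N - b.+2).+1 by lia.
  have [-> ->] : N - b.+1 = 0 /\ N - b.+2 = 0 by lia.
  rewrite cats0 /buckets /=; apply/esym; apply: size0nil; apply/eqP.
  rewrite size_filter -leqn0 leqNgt -has_count; apply/hasPn => i.
  by rewrite mem_rev mem_iota add0n => /andP[_ /f_lt]; lia.
have inU i : i < N -> f i = b.+1 -> i \in U.
  by move=> ? E; rewrite EU' mem_cat mem_bucket E eqxx; apply/orP; left.
split=> //.
- by move=> i; rewrite mem_bucket => /andP[/eqP].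
- by move=> i iN iU; apply: leqW; apply: le.
- by move=> d /st; lia.
- by move=> i iN iU E; rewrite inU in iU.
- by move=> d /st ? ?; lia.
Qed.

Lemma visiting_step b fresh more rem' id' stamp val i l U :
  visiting b fresh more (i :: l) (i :: U) rem' id' stamp val ->
  forall more' fresh' id2 stamp' val',
  more' = (if rem i %/ K == 0 then more else 1) ->
  (if stamp (dig i) == b.+1
   then [/\ fresh' = fresh, stamp' = stamp, val' = val
           & id2 = upd id' i (val (dig i))]
   else [/\ fresh' = fresh.+1, stamp' = upd stamp (dig i) b.+1,
            val' = upd val (dig i) fresh & id2 = upd id' i fresh]) ->
  visiting b fresh' more' l U (upd rem' i (rem i %/ K)) id2 stamp' val'.
Proof.
move=> [bN [EU] l_ /= /andP[iU u] fr R le st v sd I Il m0 m].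
move=> more' fresh' id2 stamp' val' Em Eif.
have [fi iN] : f i = b /\ i < N by apply: l_; rewrite mem_head.
have ltd j : dig j < K by rewrite ltn_mod.
have nU j : j \notin U -> j <> i -> j \notin i :: U.
  by move=> jU ne; rewrite inE negb_or jU andbT; apply/eqP.
have frle : fresh <= fresh' by move: Eif; case: ifP => _ [->]; lia.
have Hm0 : more' = 0 -> forall j, j < N -> j \notin U -> rem j %/ K = 0.
  rewrite Em; case: eqP => // z zm j jN jU.
  by case: (j =P i) => [->|ne] //; apply: m0 => //; apply: nU.
have Hm : more' <> 0 -> exists2 j, j < N & rem j %/ K <> 0.
  by rewrite Em; case: eqP => // nz _; exists i.
have Hrem j : j < N ->
    upd rem' i (rem i %/ K) j = if j \in U then rem j else rem j %/ K.
  move=> jN /=; case: (j =P i) => [->|ne]; first by rewrite (negPf iU).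
  by rewrite R // inE; case: eqP.
have Hle j : j < N -> j \notin U -> f j <= b.
  by move=> jN jU; case: (j =P i) => [->|ne]; [rewrite fi | apply: le => //; apply: nU].
have Hl j : j \in l -> f j = b /\ j < N by move=> jl; apply: l_; rewrite inE jl orbT.
move: Eif; case: eqP => [E|NE] [Ef Es Ev Ei]; subst fresh' stamp' val' id2.
- have [j [jN jU fj dj]] := sd _ (ltd i) E.
  have ji : j <> i by move=> ji; rewrite ji mem_head in jU.
  have [_ vj] := v j jN jU fj; rewrite dj in vj.
  have H2 k k' : k < N -> k' < N -> k \notin U -> k' \notin U ->
      upd id' i (val (dig i)) k = upd id' i (val (dig i)) k' <->
      f k = f k' /\ dig k = dig k'.
    move=> kN kN' kU kU' /=; case: (k =P i) => [->|ne]; case: (k' =P i) => [->|ne'] //.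
    + by rewrite vj I ?fi ?fj ?dj //; apply: nU.
    + by rewrite vj I ?fi ?fj ?dj //; apply: nU.
    + by apply: I => //; apply: nU.
  split=> //=.
  + by lia.
  + move=> k kN kU; case: (k =P i) => [-> _|ne fk] //.
    by apply: v => //; apply: nU.
  + move=> d dK /(sd _ dK)[k [kN kU fk dk]]; exists k; split=> //.
    by move: kU; rewrite inE negb_or => /andP[].
  + move=> k kN kU; case: (k =P i) => [_|ne]; last by apply: Il => //; apply: nU.
    by rewrite vj; apply: Il.
- have new k : k < N -> k \notin U -> k <> i -> ~ (f k = b /\ dig k = dig i).
    move=> kN kU ne [fk dk]; apply: NE; rewrite -dk.
    by have [] := v k kN (nU _ kU ne) fk.
  have lt k : k < N -> k \notin U -> k <> i -> id' k < fresh.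
    by move=> kN kU ne; apply: Il => //; apply: nU.
  split=> //=.
  + by lia.
  + by move=> d dK; case: eqP => // _; apply: st.
  + move=> k kN kU fk; case: (k =P i) => [->|ne]; first by rewrite eqxx.
    have nd : (dig k == dig i) = false by apply/eqP => dk; case: (new k).
    by rewrite nd; apply: v => //; apply: nU.
  + move=> d dK; case: eqP => [-> _|_ /(sd _ dK)[k [kN kU fk dk]]].
      by exists i.
    exists k; split=> //.
    by move: kU; rewrite inE negb_or => /andP[].
  + move=> k k' kN kN' kU kU'; case: (k =P i) => [->|ne];
      case: (k' =P i) => [->|ne'] //.
    * have ? := lt _ kN' kU' ne'.
      split=> [?|[e1 e2]]; first by lia.
      by case: (new k' kN' kU' ne'); rewrite -e1 -e2 fi.
    * have ? := lt _ kN kU ne.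
      split=> [?|[e1 e2]]; first by lia.
      by case: (new k kN kU ne); rewrite e1 e2 fi.
    * by apply: I => //; apply: nU.
  + move=> k kN kU; case: (k =P i) => [_|ne] //.
    exact: leqW (lt _ kN kU ne).
Qed.

End Traverse.

Definition traverse_cost : nat :=
  scost (rB ::= #0 ;; rCur ::= aHead @[#0] ;; rFresh ::= #0) +
  (2 * N * (scost (Ite $rCur visit next_bucket) +
     ecost ($rB < $regN)).+1 + (ecost ($rB < $regN) + 1)).

Lemma traverse_runs s : hv s regN = N -> hv s rK = K -> hv s rMore = 0 ->
  (forall i, i < N -> ha s aId i < N) ->
  (forall b, b < K -> chain (ha s aNext) (ha s aHead b) (bucket (ha s aId) N b)) ->
  (forall d, d < K -> ha s aStamp d = 0) ->
  runs traverse s traverse_cost (fun s' =>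
    [/\ forall i, i < N -> ha s' aRem i = ha s aRem i %/ K,
        forall i, i < N -> ha s' aId i < N,
        forall i j, i < N -> j < N -> ha s' aId i = ha s' aId j <->
          ha s aId i = ha s aId j /\ ha s aRem i %% K = ha s aRem j %% K,
        hv s' rMore = 0 -> forall i, i < N -> ha s aRem i %/ K = 0
      & hv s' rMore <> 0 -> exists2 i, i < N & ha s aRem i %/ K <> 0]).
Proof.
move=> EN EK Em f_lt ch st0; apply: runs_sq.
apply: runs_then; apply: runs_asg => //.
apply: runs_then; apply: runs_asg; first by rewrite /= /okix /=; split; lia.
apply: runs_asg => //; set s0 := setv _ _ _ => _.
pose vis k s' l U := k = (N - hv s' rB + size U)%N /\
  chain (ha s aNext) (hv s' rCur) l /\
  visiting (ha s aId) (ha s aRem) (hv s' rB) (hv s' rFresh) (hv s' rMore) l U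
    (ha s' aRem) (ha s' aId) (ha s' aStamp) (ha s' aVal).
pose J k s' := exists l U, vis k s' l U.
apply: (runs_loop (I := J)).
- exists (bucket (ha s aId) N 0), (buckets (ha s aId) N 0 N).
  have EU : buckets (ha s aId) N 0 N =
      bucket (ha s aId) N 0 ++ buckets (ha s aId) N 1 (N - 1).
    by case: (N) N_pos => // n' _; rewrite subn1.
  have inU i : i < N -> i \in buckets (ha s aId) N 0 N.
    by move=> iN; rewrite mem_buckets /= f_lt.
  split; first by rewrite /= size_buckets //; lia.
  split; first by rewrite /=; apply: ch.
  split=> //=.
  + by move=> i; rewrite mem_bucket => /andP[/eqP].
  + exact: buckets_uniq.
  + by rewrite size_buckets.
  + by move=> i iN; rewrite inU.
  + by move=> i iN; rewrite inU.
  + by move=> d dK; rewrite st0.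
  + by move=> i iN; rewrite inU.
  + by move=> d dK; rewrite st0.
  + by move=> i j iN jN; rewrite inU.
  + by move=> i iN; rewrite inU.
  + by move=> _ i iN; rewrite inU.
- by [].
- move=> k s' [l [U [Ek [C V]]]] A /=.
  have -> : hv s' regN = N by rewrite A.1.
  have EK' : hv s' rK = K by rewrite A.1.
  have Hn : ha s' aNext = ha s aNext by rewrite A.2.
  have Hh : ha s' aHead = ha s aHead by rewrite A.2.
  move=> lt; have {}lt : hv s' rB < N by case: ltnP lt.
  apply: runs_ite => //= cur.
    case: l C V => [C|i l [Ec C]] V; first by rewrite C in cur.
    have [fi iN] := vis_l V (mem_head i l).
    case: U Ek V => [|i' U] Ek V; first by have := vis_U V.
    have Ei : i' = i by have := vis_U V; case.
    subst i'; have := vis_fresh V; rewrite /= => ?.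
    apply: runs_weaken (visit_runs EK' Ec iN lt _) (leqnn _) _; first by lia.
    move=> s2 A2 [Ecur Emo Erem Eif] _.
    have Eb : hv s2 rB = hv s' rB by apply: A2.1.
    have remi : ha s' aRem i = ha s aRem i by rewrite (vis_rem V iN) mem_head.
    exists k.-1; first by rewrite Ek /=; lia.
    exists l, U; split; first by rewrite Ek Eb /=; lia.
    split; first by rewrite Ecur Hn.
    rewrite Eb Erem remi; rewrite remi in Emo Eif.
    apply: (visiting_step V Emo).
    by move: Eif; case: ifP => _ [-> -> -> ->].
  case: l C V => [C|i l [Ec _]] V; last by rewrite Ec in cur.
  apply: runs_then; apply: runs_asg; first by rewrite /=; split=> //; lia.
  apply: runs_asg; first by rewrite /= /okix /=; repeat split; lia.
  rewrite /= Hh addn1 => _; exists k.-1; first by lia.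
  exists (bucket (ha s aId) N (hv s' rB).+1), U; split; first by rewrite Ek /=; lia.
  split; first by rewrite /=; apply: ch; lia.
  exact: visiting_next.
- move=> k s' [l [U [Ek [C V]]]] A /=.
  have -> : hv s' regN = N by rewrite A.1.
  move=> ge; have {}ge : hv s' rB = N.
    by have := vis_b V; case: ltnP ge => //; lia.
  have EU : U = [::].
    rewrite (vis_U V) ge; have -> : N - N.+1 = 0 by lia.
    case: l V {C} => [|i l] V; first by [].
    by have [+ /f_lt] := vis_l V (mem_head i l); lia.
  rewrite EU in V; split.
  + by move=> i iN; rewrite (vis_rem V iN).
  + move=> i iN; apply: leq_trans (vis_id_lt V iN isT) _.
    by have := vis_fresh V; lia.
  + by move=> i j iN jN; apply: (vis_id V).
  + by move=> z i iN; apply: (vis_more0 V z).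
  + by move=> z; apply: (vis_more V z).
Qed.

End Rename.

Lemma eqn_modXS x y K t :
  x = y %[mod K ^ t.+1] <->
  x = y %[mod K ^ t] /\ x %/ K ^ t = y %/ K ^ t %[mod K].
Proof.
rewrite !modn_divl -expnS; split=> [E|[E1 E2]].
  have dv : K ^ t %| K ^ t.+1 by rewrite expnS dvdn_mull.
  by rewrite -[x %% K ^ t](modn_dvdm _ dv) E modn_dvdm.
have dv : K ^ t %| K ^ t.+1 by rewrite expnS dvdn_mull.
rewrite (divn_eq (x %% K ^ t.+1) (K ^ t)) E2 (modn_dvdm _ dv) E1.
by rewrite -(modn_dvdm _ dv) -divn_eq.
Qed.

Section RenameLoop.
Variables N M W c : nat.
Notation runs := (runs N M W).
Notation K := N.+1.
Hypothesis M_large : K <= M.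
Hypothesis W_large : 2 * K <= W.
Hypothesis N_pos : 0 < N.

Definition pass_cost : nat :=
  scost (rMore ::= #0) + ((K * (scost clear_bucket + 8) + 6) +
    ((N * (scost link_bucket + 8) + 6) + traverse_cost N)).

Lemma rename_pass_runs s : hv s regN = N -> hv s rK = K ->
  (forall i, i < N -> ha s aId i < N) ->
  runs rename_pass s pass_cost (fun s' =>
    [/\ forall i, i < N -> ha s' aRem i = ha s aRem i %/ K,
        forall i, i < N -> ha s' aId i < N,
        forall i j, i < N -> j < N -> ha s' aId i = ha s' aId j <->
          ha s aId i = ha s aId j /\ ha s aRem i %% K = ha s aRem j %% K,
        hv s' rMore = 0 -> forall i, i < N -> ha s aRem i %/ K = 0
      & hv s' rMore <> 0 -> exists2 i, i < N & ha s aRem i %/ K <> 0]).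
Proof.
move=> EN EK f_lt; apply: runs_sq; apply: runs_asg => // _; set s1 := setv _ _ _.
apply: runs_sq.
have X := clear_runs M_large W_large N_pos (s := s1) EK.
apply: (runs_weaken X (leqnn _)).
move=> s2 A2 H2 _.
have EN2 : hv s2 regN = N by rewrite A2.1.
have Eid2 : ha s2 aId = ha s aId by rewrite A2.2.
have f_lt2 : forall i, i < N -> ha s2 aId i < N by rewrite Eid2.
apply: runs_sq.
apply: runs_weaken (link_runs M_large W_large N_pos EN2 f_lt2 (fun b lt => (H2 b
    lt).1)) (leqnn _) _.
move=> s3 A3 H3 _.
have Eid3 : ha s3 aId = ha s aId by rewrite A3.2.
have Erem3 : ha s3 aRem = ha s aRem by rewrite A3.2 // A2.2.
have St : ha s3 aStamp = ha s2 aStamp by rewrite A3.2.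
rewrite -Eid3 -Erem3; apply: traverse_runs; rewrite // ?Eid3 //.
- by rewrite A3.1.
- by rewrite A3.1 // A2.1.
- by rewrite A3.1 // A2.1.
- by rewrite -Eid2.
- by move=> d dK; rewrite St (H2 d dK).2.
Qed.

Definition rename_cost : nat :=
  (N * (scost (aRem @@[$rI] ::= raw @[$rI]) + 8) + 6) +
  (scost (rMore ::= #1) + (c.+1 * (pass_cost + 1).+1 + 2)).

Lemma rename_runs s : hv s regN = N -> hv s rK = K ->
  (forall i, i < N -> ha s aId i = 0) ->
  (forall i, i < N -> ha s raw i < K ^ c) ->
  runs rename s rename_cost (fun s' =>
    (forall i, i < N -> ha s' aId i < N) /\
    (forall i j, i < N -> j < N ->
       ha s' aId i = ha s' aId j <-> ha s raw i = ha s raw j)).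
Proof.
move=> EN EK Hid Hraw; apply: runs_sq.
pose I j s' := forall i, i < j -> ha s' aRem i = ha s raw i.
apply: (runs_for (I := I)); rewrite //=; first by lia.
  move=> i s' lti A Ei IH; have Er : ha s' raw = ha s raw by rewrite A.2.
  apply: runs_sto; rewrite /= /okix /=; try by repeat split; lia.
  rewrite /I /= Ei Er => j; rewrite ltnS leq_eqVlt.
  by case: eqP => [->|_ /=]; last exact: IH.
move=> s1 A1 H1 _; apply: runs_sq; apply: runs_asg => // _.
pose J k s' := exists t, [/\ t + k = c.+1,
  forall i, i < N -> ha s' aRem i = ha s raw i %/ K ^ t,
  forall i, i < N -> ha s' aId i < N,
  forall i j, i < N -> j < N -> ha s' aId i = ha s' aId j <->
    ha s raw i = ha s raw j %[mod K ^ t]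
  & (hv s' rMore = 0 -> forall i, i < N -> ha s raw i %/ K ^ t = 0) /\
    (hv s' rMore <> 0 -> t < c.+1)].
have Eid1 : ha s1 aId = ha s aId by rewrite A1.2.
apply: (runs_loop (I := J)).
- exists 0; split=> //=.
  + by move=> i iN; rewrite H1 // divn1.
  + by move=> i iN; rewrite Eid1 Hid.
  + by move=> i j iN jN; rewrite Eid1 !Hid // !modn1.
- by [].
- move=> k s' [t [Et Hr Hi Hij [_ Hm]]] A /= /eqP /Hm lt.
  have EN' : hv s' regN = N by rewrite A.1 //= A1.1.
  have EK' : hv s' rK = K by rewrite A.1 //= A1.1.
  apply: runs_weaken (rename_pass_runs EN' EK' Hi) (leqnn _) _.
  move=> s2 A2 [Hr2 Hi2 Hij2 Hm0 Hm2] _; exists k.-1; first by lia.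
  have dv i : i < N -> ha s' aRem i %/ K = ha s raw i %/ K ^ t.+1.
    by move=> iN; rewrite Hr // -divnMA -expnSr.
  exists t.+1; split; first by lia.
  + by move=> i iN; rewrite Hr2 // dv.
  + exact: Hi2.
  + move=> i j iN jN; rewrite Hij2 // Hij // eqn_modXS !Hr //.
  split=> [z i iN|/Hm2[i iN]]; first by rewrite -dv // Hm0.
  rewrite dv // => nz; have : K ^ t.+1 < K ^ c.
    apply: leq_ltn_trans (Hraw i iN).
    by rewrite leqNgt; apply/negP => /divn_small.
  by rewrite ltn_exp2l; lia.
- move=> k s' [t [Et Hr Hi Hij [Hm0 _]]] A /= /Hm0 z; split=> // i j iN jN.
  rewrite Hij //; have sm i' : i' < N -> ha s raw i' %% K ^ t = ha s raw i'.
    move=> /z z'; rewrite modn_small // ltnNge; apply/negP => le.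
    by have := divn_gt0 (ha s raw i') (d := K ^ t);
        rewrite z' expn_gt0 /= => /(_ isT); rewrite le.
  by rewrite !sm.
Qed.
End RenameLoop.

(** * Common characters, next occurrences and the automaton *)

Local Notation rInf := 5 (only parsing).
Local Notation rCnt := 6 (only parsing).
Local Notation rW := 7 (only parsing).
Local Notation rJ := 15 (only parsing).
Local Notation rC := 16 (only parsing).
Local Notation rV := 17 (only parsing).
Local Notation rX := 18 (only parsing).
Local Notation rY := 19 (only parsing).
Local Notation rk := 20 (only parsing).
Local Notation rRows := 21 (only parsing).
Local Notation rT := 22 (only parsing).

Local Notation aMark := 6 (only parsing).
Local Notation aCid := 7 (only parsing).
Local Notation aNxt := 8 (only parsing).
Local Notation aDfa := 9 (only parsing).
Local Notation aD := 10 (only parsing).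

Definition mark_B : stmt := aMark @@[aId @[$rm + $rI]] ::= #1.

Definition number_A : stmt :=
  Ite (aMark @[aId @[$rI]])
    (Ite (aCid @[aId @[$rI]])
       Nop
       (rCnt ::= $rCnt + #1 ;; aCid @@[aId @[$rI]] ::= $rCnt))
    Nop.

Definition nxt_cell : stmt :=
  Ite ($rD < $rn)
    (Ite ($rC == aCid @[aId @[$rm + $rD]])
       (rV ::= $rD + #1)
       (rV ::= aNxt @[($rD + #1) * $rW + $rC]))
    (rV ::= $rInf) ;;
  Ite $rC Nop (rV ::= $rInf) ;;
  aNxt @@[$rD * $rW + $rC] ::= $rV.

Definition nxt_row : stmt := rD ::= $rInf - $rJ ;; For rC rW nxt_cell.

(* In row 0 the cell read first has never been written, hence is 0.  Rows after
   a character of [P] that does not occur in [A] are junk, but correspond to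
   unreachable states. *)
Definition dfa_cell : stmt :=
  rV ::= aDfa @[$rX * $rm + $rI] ;;
  Ite (raw @[$rI] == raw @[$rm + $rn + $rk])
    (rY ::= $rV ;; rV ::= $rk + #1)
    Nop ;;
  aDfa @@[$rk * $rm + $rI] ::= $rV.

Definition dfa_row : stmt :=
  rY ::= #0 ;; For rI rm dfa_cell ;; rX ::= $rY.

Definition setup : stmt :=
  rK ::= $regN + #1 ;; rInf ::= $rn + #1 ;; rRows ::= $rn + #2 ;;
  rT ::= ($rm + #1) * $rr.

Definition tables : stmt :=
  For rI rn mark_B ;;
  For rI rm number_A ;;
  rW ::= $rCnt + #1 ;;
  For rJ rRows nxt_row ;;
  For rk rr dfa_row ;;
  For rI rT (aD @@[$rI] ::= $rInf).

Lemma ltn_cell j h c w : j < h -> c < w -> j * w + c < h * w.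
Proof.
move=> jh cw; apply: (@leq_trans (j.+1 * w)); first by rewrite mulSn addnC ltn_add2r.
by rewrite leq_mul2r jh orbT.
Qed.

Lemma eq_cell j c j' c' w : c < w -> c' < w ->
  (j * w + c == j' * w + c') = (j == j') && (c == c').
Proof.
move=> cw cw'; apply/eqP/andP => [E|[/eqP -> /eqP ->] //].
have w0 : 0 < w by lia.
have := congr1 (divn^~ w) E; rewrite !divnMDl // !divn_small // !addn0 => ->.
by have := congr1 (modn^~ w) E; rewrite !modnMDl !modn_small // => ->; rewrite !eqxx.
Qed.

Section Tables.
Variables (M W : nat) (A B P : seq nat).
Notation m := (size A).
Notation n := (size B).
Notation r := (size P).
Notation N := (m + n + r).
Notation sigma := (size (common_chars A B)).
Notation runs := (runs N M W).
Hypothesis r_pos : 0 < r.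
Hypothesis M_N : N < M.
Hypothesis M_nxt : (n + 2) * (sigma + 1) <= M.
Hypothesis M_dfa : (m + 1) * r <= M.
Hypothesis W_large : 2 * M <= W.

Let x p := nth 0 (A ++ B ++ P) p.

Lemma input_A i : i < m -> x i = nth 0 A i.
Proof. by move=> lt; rewrite /x nth_cat lt. Qed.

Lemma input_B j : j < n -> x (m + j) = nth 0 B j.
Proof.
move=> lt; rewrite /x nth_cat ltnNge leq_addr /= addKn nth_cat lt //.
Qed.

Lemma input_P k : x (m + n + k) = nth 0 P k.
Proof.
by rewrite /x catA nth_cat size_cat ltnNge leq_addr /= addKn.
Qed.

Section Columns.
Variable id : nat -> nat.
Hypothesis id_lt : forall i, i < N -> id i < N.
Hypothesis id_inj : forall i j, i < N -> j < N -> id i = id j <-> x i = x j.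

Definition marked k (mk : nat -> nat) :=
  forall i, i < N -> mk (id i) != 0 = (x i \in take k B).

Lemma mark_runs s : hv s rm = m -> hv s rn = n -> ha s aId = id ->
  (forall i, ha s aMark i = 0) ->
  runs (For rI rn mark_B) s (n * (scost mark_B + 8) + 6)
    (fun s' => marked n (ha s' aMark)).
Proof.
move=> Em En Eid H0.
apply: (runs_for (I := fun j s' => marked j (ha s' aMark))); rewrite //=; first by lia.
  by move=> i _; rewrite take0 H0.
move=> j s' ltj Ag Ej IH.
have Em' : hv s' rm = m by rewrite Ag.1.
have Eid' : ha s' aId = id by rewrite Ag.2.
have ? : id (m + j) < N by apply: id_lt; lia.
apply: runs_sto; rewrite /= /okix /= ?Em' ?Ej ?Eid'; try by repeat split; lia.
move=> i iN; rewrite (take_nth 0) // mem_rcons inE -IH // -input_B //.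
have mjN : m + j < N by lia.
rewrite /=; case: (id i =P id (m + j)) => [E|ne].
  by rewrite (proj1 (id_inj iN mjN) E) eqxx.
by case: (x i =P x (m + j)) => // /(proj2 (id_inj iN mjN)).
Qed.

Definition numbered k cnt (g : nat -> nat) :=
  let F := [seq a <- take k A | a \in B] in
  [/\ cnt = size (undup F),
      forall i, i < N -> g (id i) != 0 = (x i \in F),
      forall i, i < N -> g (id i) <= cnt
    & forall i j, i < N -> j < N -> g (id i) != 0 -> g (id i) = g (id j) ->
        id i = id j].

Lemma size_undup_rcons (s : seq nat) a :
  size (undup (rcons s a)) = (a \notin s) + size (undup s).
Proof.
have -> : size (undup (rcons s a)) = size (undup (a :: s)).
  by apply: perm_size; apply: perm_undup => b; rewrite mem_rcons.
by rewrite /=; case: (a \in s).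
Qed.

Lemma number_runs s : hv s rm = m -> hv s rCnt = 0 -> ha s aId = id ->
  (forall i, ha s aCid i = 0) -> marked n (ha s aMark) ->
  runs (For rI rm number_A) s (m * (scost number_A + 8) + 6)
    (fun s' => numbered m (hv s' rCnt) (ha s' aCid)).
Proof.
move=> Em Ec Eid H0 Hmk.
apply: (runs_for (I := fun k s' => numbered k (hv s' rCnt) (ha s' aCid)));
    rewrite //=; first by lia.
  rewrite /numbered take0 /=; split=> // i; rewrite ?H0 //.
move=> k s' ltk Ag Ek [Hc H1 H2 H3].
have Eid' : ha s' aId = id by rewrite Ag.2.
have Emk' : ha s' aMark = ha s aMark by rewrite Ag.2.
have kN : k < N by lia.
have ? := id_lt kN.
have Hx : x k = nth 0 A k by apply: input_A.
have Hm : ha s aMark (id k) != 0 = (x k \in B) by rewrite Hmk // take_size.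
rewrite /numbered (take_nth 0) // filter_rcons -Hx.
have ok : okE N M W s' (aId @[$rI]) by rewrite /= /okix /=; split=> //; lia.
apply: runs_ite; rewrite /= ?Ek ?Eid' ?Emk' /okix /=; first by repeat split; lia.
  rewrite Hm => ->; apply: runs_ite; rewrite /= ?Ek ?Eid' /okix /=;
      first by repeat split; lia.
    rewrite H1 // => kF; apply: runs_nop; split=> //.
    + by rewrite size_undup_rcons kF.
    + move=> i iN; rewrite H1 // mem_rcons inE; case: eqP => // ->.
      by rewrite kF.
  move=> /eqP z; have kF : x k \notin [seq a <- take k A | a \in B].
    by rewrite -H1 // z.
  have cle : hv s' rCnt <= k.
    rewrite Hc; apply: leq_trans (size_undup _) _; rewrite size_filter.
    by apply: leq_trans (count_size _ _) _; rewrite size_takel // ltnW.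
  apply: runs_then; apply: runs_asg; first by rewrite /=; split=> //; lia.
  apply: runs_sto; rewrite /= ?Ek ?Eid' /okix /=; try by repeat split; lia.
  have eqid i : i < N -> (id i == id k) = (x i == x k).
    by move=> iN; apply/eqP/eqP; apply id_inj.
  split.
  + by rewrite size_undup_rcons kF Hc addn1.
  + move=> i iN; rewrite /= mem_rcons inE eqid //.
    by case: (x i =P x k) => //= _; rewrite ?addn1 ?H1.
  + by move=> i iN /=; case: eqP => // _; rewrite addn1 leqW // H2.
  + move=> i j iN jN /=; case: (id i =P id k) => [->|ne];
    case: (id j =P id k) => [->|ne'] //.
    * by move=> _ E; have := H2 j jN; rewrite -E; lia.
    * by move=> _ E; have := H2 i iN; rewrite E; lia.
    * exact: H3.
move=> /eqP; rewrite -[_ == 0]negbK Hm => /negPf ->.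
by apply: runs_nop.
Qed.

Variables (cid : nat -> nat).
Hypothesis cidP : numbered m sigma cid.
Notation col i := (cid (id i)).
Notation w := (sigma + 1).

Lemma col_lt i : i < N -> col i < w.
Proof. by move=> iN; have [_ _ le _] := cidP; rewrite addn1 ltnS le. Qed.

Lemma col_absent i : i < m -> col i = 0 -> nth 0 A i \notin B.
Proof.
move=> im z; have [_ H _ _] := cidP; have iN : i < N by lia.
have := H i iN; rewrite z take_size mem_filter input_A // mem_nth // andbT /=.
by move=> <-.
Qed.

Lemma col_eq i j : i < m -> j < n -> col i != 0 ->
  (col i == col (m + j)) = (nth 0 B j == nth 0 A i).
Proof.
move=> im jn nz; have [_ _ _ H] := cidP.
have iN : i < N by lia. have jN : m + j < N by lia.
rewrite -(input_A im) -(input_B jn) eq_sym [RHS]eq_sym; apply/eqP/eqP.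
  by move=> E; apply/(id_inj iN jN); apply: H => //; rewrite E.
by move/(id_inj iN jN) => ->.
Qed.

Definition nxt_ok (nx : nat -> nat) j i :=
  nx (j * w + col i) = next_end B j (nth 0 A i).

Lemma nxt_cell_runs s d c : hv s rm = m -> hv s rn = n -> hv s rInf = n.+1 ->
  hv s rW = w -> hv s rD = d -> hv s rC = c -> ha s aId = id -> ha s aCid = cid ->
  d < n + 2 -> c < w ->
  (forall i, i < m -> d < n -> nxt_ok (ha s aNxt) d.+1 i) ->
  runs nxt_cell s (scost nxt_cell) (fun s' => exists v,
    ha s' aNxt = upd (ha s aNxt) (d * w + c) v /\
    forall i, i < m -> col i = c -> v = next_end B d (nth 0 A i)).
Proof.
move=> Em En Einf Ew Ed Ec Eid Ecid dn cw IH.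
have lt1 := ltn_cell dn cw.
pose good v := exists u, v = u /\
  forall i, i < m -> col i = c -> c != 0 -> u = next_end B d (nth 0 A i).
apply: runs_then.
apply: (@runs_weaken _ _ _ _ _ _ _
  (fun s' => ha s' = ha s /\ good (hv s' rV))); [| exact: leqnn |].
  apply: runs_ite; rewrite //= En Ed => lt.
    have {}lt : d < n by case: ltnP lt.
    have lt2 : d.+1 * w + c < (n + 2) * w by apply: ltn_cell => //; lia.
    have ? : id (m + d) < N by apply: id_lt; lia.
    apply: runs_ite; rewrite /= /okix /= ?Em ?Ed ?Eid ?Ecid ?Ec; try by repeat split;
        lia.
      move=> /= E; apply: runs_asg; rewrite /= ?Ed; first by repeat split; lia.
      split=> //; eexists; split; first by [].
      move=> i im ci nz; rewrite next_end_rec // -col_eq ?ci //.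
      by move: E; case: (c =P col (m + d)) => // _ _; rewrite addn1.
    move=> /= E; apply: runs_asg; rewrite /= /okix /= ?Ed ?Ew ?Ec ?[d + 1]addn1.
      by repeat split; lia.
    split=> //; eexists; split; first by [].
    move=> i im ci nz; rewrite next_end_rec // -col_eq ?ci //.
    by move: E; case: (c =P col (m + d)) => // _ _; rewrite -IH // ci addn1.
  apply: runs_asg => //=; rewrite Einf; split=> //; eexists; split; first by [].
  by move=> i im ci nz; rewrite next_end_inf //; case: ltnP lt.
move=> s1 A1 [Ha1 [u [Eu Hu]]].
have [Ew1 Ed1 Ec1 Ei1] : [/\ hv s1 rW = w, hv s1 rD = d, hv s1 rC = c & hv s1 rInf =
    n.+1].
  by rewrite !A1.1.
apply: runs_then; apply: runs_ite; rewrite //= Ec1 => cz.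
  apply: runs_nop; apply: runs_sto; rewrite /= /okix /= ?Ew1 ?Ed1 ?Ec1 ?Ha1;
      try by repeat split; lia.
  by exists u; rewrite Eu; split=> // i im ci; apply: Hu.
apply: runs_asg => //; apply: runs_sto; rewrite /= /okix /= ?Ew1 ?Ed1 ?Ec1 ?Ha1;
    try by repeat split; lia.
exists (hv s1 rInf); split=> // i im ci.
by rewrite Ei1 next_end_absent // col_absent // ci.
Qed.

Definition nxt_cost : nat :=
  (n + 2) * (scost (rD ::= $rInf - $rJ) + (w * (scost nxt_cell + 8) + 6) + 8) + 6.

Lemma nxt_runs s : hv s rm = m -> hv s rn = n -> hv s rInf = n.+1 ->
  hv s rRows = n + 2 -> hv s rW = w -> ha s aId = id -> ha s aCid = cid ->
  runs (For rJ rRows nxt_row) s nxt_cost (fun s' =>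
    forall i j, i < m -> j < n + 2 -> nxt_ok (ha s' aNxt) j i).
Proof.
move=> Em En Einf Er Ew Eid Ecid.
pose I t s' := forall i j, i < m -> n + 2 <= j + t -> j < n + 2 ->
  nxt_ok (ha s' aNxt) j i.
apply: (runs_for (I := I)); rewrite //=; first by lia.
- by move=> i j _; lia.
- move=> t s' tn A1 Et IH; pose d := n.+1 - t.
  have Einf' : hv s' rInf = n.+1 by rewrite A1.1.
  apply: runs_sq; apply: runs_asg => // _.
  rewrite (_ : ev _ _ = d); last by rewrite /= Einf' Et.
  pose J c s2 := (forall i j, i < m -> d < j -> j < n + 2 -> nxt_ok (ha s2 aNxt) j i) /\
    (forall i, i < m -> col i < c -> nxt_ok (ha s2 aNxt) d i).
  apply: (runs_for (I := J)); rewrite //=.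
  + by rewrite A1.1 //= Ew.
  + by lia.
  + by split=> // i j im dj jn; apply: IH => //; rewrite /d in dj; lia.
  + move=> c s2 cw A2 Ec [IH1 IH2].
    have dn : d < n + 2 by rewrite /d; lia.
    apply: runs_weaken (nxt_cell_runs (d := d) (c := c) _ _ _ _ _ _ _ _ dn cw _)
        (leqnn _) _;
      try by [exact: Ec | rewrite ?A2.1 ?A2.2 //= ?A1.1 ?A1.2].
      by move=> i im dltn; apply: IH1 => //; lia.
    move=> s3 A3 [v [Ev Hv]]; split=> [i j im dj jn|i im] /=.
      rewrite /nxt_ok Ev /= eq_cell ?col_lt ?(gtn_eqF dj) //=; try lia.
      exact: IH1.
    rewrite ltnS leq_eqVlt /nxt_ok Ev /= eq_cell ?col_lt //; try lia.
    rewrite eqxx /=; case: eqP => [ci _|_ /= lt]; last exact: IH2.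
    exact: Hv.
  + move=> s2 A2 [IH1 IH2] i j im jt jn.
    case: (ltnP d j) => dj; first exact: IH1.
    have -> : j = d by rewrite /d in dj *; lia.
    by apply: IH2 => //; apply: col_lt; lia.
- by move=> s' A1 IH i j im jn; apply: IH => //; lia.
Qed.

End Columns.

Definition dfa_ok (f : nat -> nat) k i : Prop :=
  f (k * m + i) <= k.+1 /\
  ({subset take k P <= A} -> f (k * m + i) = step P k (nth 0 A i)).

Definition dfa_cost : nat :=
  r * (scost (rY ::= #0) +
       ((m * (scost dfa_cell + 8) + 6) + scost (rX ::= $rY)) + 8) + 6.

Lemma subset_take (k k' : nat) : k <= k' ->
  {subset take k' P <= A} -> {subset take k P <= A}.
Proof.
move=> le sub a; rewrite -(minn_idPl le) take_min => /mem_take.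
exact: sub.
Qed.

Lemma dfa_runs s : hv s rm = m -> hv s rn = n -> hv s rr = r -> hv s rX = 0 ->
  (forall i, i < N -> ha s raw i = x i) -> (forall a, ha s aDfa a = 0) ->
  runs (For rk rr dfa_row) s dfa_cost (fun s' =>
    forall k i, k < r -> i < m -> dfa_ok (ha s' aDfa) k i).
Proof.
move=> Em En Er EX Hraw H0.
have mr : m * r <= M by lia.
pose I k s' := [/\ forall k' i, k' < k -> i < m -> dfa_ok (ha s' aDfa) k' i,
  forall a, k * m <= a -> ha s' aDfa a = 0,
  hv s' rX <= k.-1
  & 0 < k -> {subset take k P <= A} -> hv s' rX = fallback P k].
apply: (runs_for (I := I)); rewrite //=; first by lia.
- by split=> //=; rewrite EX.
- move=> k s' kr A1 Ek [IH1 IH2 IH3 IH4].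
  apply: runs_sq; apply: runs_asg => // _; set s1 := setv _ _ _.
  apply: runs_sq.
  pose X := hv s' rX.
  pose J i s2 := [/\ forall k' i, k' < k -> i < m -> dfa_ok (ha s2 aDfa) k' i,
    forall i', i' < i -> dfa_ok (ha s2 aDfa) k i',
    forall a, k * m + i <= a -> ha s2 aDfa a = 0,
    hv s2 rY <= k
    & {subset take k P <= A} -> nth 0 P k \in take i A ->
      hv s2 rY = fallback P k.+1].
  apply: (runs_for (I := J)) => //.
  + by rewrite /= A1.1.
  + by lia.
  + by split=> //= a; rewrite ?addn0; [apply: IH2 | rewrite take0].
  + move=> i s2 im A2 Ei [J1 J2 J3 J4 J5].
    have Em2 : hv s2 rm = m by rewrite A2.1 //= A1.1.
    have En2 : hv s2 rn = n by rewrite A2.1 //= A1.1.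
    have Ek2 : hv s2 rk = k by rewrite A2.1.
    have EX2 : hv s2 rX = X by rewrite A2.1.
    have Hraw2 p : p < N -> ha s2 raw p = x p.
      by move=> pN; rewrite A2.2 //= A1.2 // Hraw.
    have lt1 : k * m + i < r * m by apply: ltn_cell.
    have Xr : X < r by rewrite /X; lia.
    have lt2 : X * m + i < r * m by apply: ltn_cell.
    rewrite mulnC in mr.
    pose t := ha s2 aDfa (X * m + i).
    have [tk Ht] : t <= k /\ ({subset take k P <= A} ->
        t = if k == 0 then 0 else step P (fallback P k) (nth 0 A i)).
      rewrite /t; case: (posnP k) => [k0|kpos].
        by rewrite J3 // k0; lia.
      have Xk : X < k by rewrite /X; lia.
      have [le E] := J1 _ _ Xk im.
      split=> [|sub]; first by lia.
      by rewrite E ?gtn_eqF -?IH4 //; apply: subset_take sub; apply: ltnW.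
    apply: runs_then; apply: runs_asg.
      by rewrite /= /okix /= ?EX2 ?Em2 ?Ei; repeat split; lia.
    rewrite (_ : ev _ _ = t); last by rewrite /= EX2 Em2 Ei.
    pose hit := nth 0 A i == nth 0 P k.
    have Ehit : (ha s2 raw i == ha s2 raw (m + n + k)) = hit.
      rewrite !Hraw2; [ | by lia | by lia].
      by rewrite input_A // input_P.
    pose v := if hit then k.+1 else t.
    have vok : v <= k.+1 /\ ({subset take k P <= A} -> v = step P k (nth 0 A i)).
      rewrite /v /hit eq_sym; case: eqP => [<-|/eqP ne].
        by rewrite step_match.
      by split=> [|/Ht ->]; [lia | rewrite (step_fallback kr ne)].
    apply: runs_then; apply: (@runs_weaken _ _ _ _ _ _ _ (fun s3 =>
      [/\ ha s3 = ha s2, hv s3 rV = v & hv s3 rY = if hit then t else hv s2 rY]));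
      [| exact: leqnn |].
      apply: runs_ite.
      * by rewrite /= /okix /= Em2 En2 Ek2 Ei; repeat split; lia.
      * rewrite /= Em2 En2 Ek2 Ei Ehit => h.
        apply: runs_then; apply: runs_asg => //; apply: runs_asg.
          by rewrite /= Ek2; repeat split; lia.
        by rewrite /= Ek2 /v; case: (hit) h => //; rewrite addn1.
      * rewrite /= Em2 En2 Ek2 Ei Ehit => h.
        by apply: runs_nop; rewrite /= /v; case: (hit) h.
    move=> s3 A3 [Ha3 Ev3 Ey3].
    have [Em3 Ek3 Ei3] : [/\ hv s3 rm = m, hv s3 rk = k & hv s3 rI = i].
      by rewrite !A3.1.
    apply: runs_sto; rewrite /= /okix /= ?Em3 ?Ek3 ?Ei3 ?Ev3 ?Ha3;
        try by repeat split; lia.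
    split; rewrite /= ?Ey3.
    * move=> k' i' k'k i'm; rewrite /dfa_ok /= eq_cell // ltn_eqF //=.
      exact: J1.
    * move=> i'; rewrite ltnS leq_eqVlt /dfa_ok /= => /orP[/eqP ->|lt].
        by rewrite eqxx.
      by rewrite eq_cell ?(ltn_trans lt) // eqxx ltn_eqF //=; apply: J2.
    * by move=> a le; rewrite gtn_eqF; [apply: J3; lia | lia].
    * by case: ifP.
    * move=> sub; rewrite (take_nth 0) // mem_rcons inE; case: ifP => [/eqP h _|nh].
        rewrite Ht // h; case: (posnP k) => [->|kpos]; first by rewrite fallback1.
        by rewrite fallbackS ?kpos.
      by rewrite eq_sym -[_ == _]/hit nh /=; apply: J5.
  + move=> s2 A2 [J1 J2 J3 J4 J5] _; apply: runs_asg => //; split=> /=.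
    * move=> k' i; rewrite ltnS leq_eqVlt => /orP[/eqP ->|lt] im;
        [exact: J2 | exact: J1].
    * by move=> a le; apply: J3; rewrite mulSn in le; lia.
    * by [].
    * move=> _ sub; apply: J5; first by apply: subset_take sub.
      by rewrite take_size; apply: sub; rewrite (take_nth 0) // mem_rcons mem_head.
- by move=> s' A1 [IH1 _ _ _] k i kr im; apply: IH1.
Qed.

Lemma init_runs s : hv s rInf = n.+1 -> hv s rT = (m + 1) * r ->
  runs (For rI rT (aD @@[$rI] ::= $rInf)) s
    ((m + 1) * r * (scost (aD @@[$rI] ::= $rInf) + 8) + 6)
    (fun s' => forall a, a < (m + 1) * r -> ha s' aD a = n.+1).
Proof.
move=> Einf ET.
apply: (runs_for (I := fun j s' => forall a, a < j -> ha s' aD a = n.+1));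
    rewrite //=; first by lia.
move=> i s' lti A1 Ei IH.
have Einf' : hv s' rInf = n.+1 by rewrite A1.1.
apply: runs_sto; rewrite /= /okix /= ?Ei ?Einf'; try by repeat split; lia.
move=> a; rewrite /= ltnS leq_eqVlt; case: eqP => // _; exact: IH.
Qed.

End Tables.

(** * The dynamic program along diagonals *)

Local Notation rDl := 23 (only parsing).
Local Notation rS := 24 (only parsing).
Local Notation rF := 25 (only parsing).
Local Notation rU := 26 (only parsing).
Local Notation rK2 := 27 (only parsing).
Local Notation rFz := 28 (only parsing).

Local Notation aPtr := 11 (only parsing).
Local Notation aChr := 12 (only parsing).
Local Notation aPar := 13 (only parsing).

(* On diagonal [dl], cell [s * r + k] of [aD] holds [d(dl + s, s, k)] and that of
   [aPtr] the list node of a witness; [rFz] is the first free node. *)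
Definition improve : stmt :=
  aD @@[$rS * $rr + $rK2] ::= $rU ;;
  aChr @@[$rFz] ::= raw @[$rI] ;;
  aPar @@[$rFz] ::= aPtr @[($rS - #1) * $rr + $rk] ;;
  aPtr @@[$rS * $rr + $rK2] ::= $rFz ;;
  rFz ::= $rFz + #1 ;;
  rF ::= #1.

Definition relax : stmt :=
  rV ::= aD @[($rS - #1) * $rr + $rk] ;;
  rU ::= aNxt @[$rV * $rW + aCid @[aId @[$rI]]] ;;
  rK2 ::= aDfa @[$rk * $rm + $rI] ;;
  Ite (aD @[$rS * $rr + $rk] < $rInf) (rF ::= #1) Nop ;;
  Ite ($rK2 < $rr)
    (Ite ($rU < aD @[$rS * $rr + $rK2]) improve Nop)
    Nop.

Definition dp_row : stmt :=
  (rI ::= $rDl + $rS ;; rS ::= $rS + #1 ;; rF ::= #0) ;; For rk rr relax.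

Definition diagonal : stmt :=
  (rS ::= #0 ;; rF ::= #1) ;;
  Loop ($rF * ($rDl + $rS < $rm)) dp_row ;;
  rDl ::= $rDl + #1.

Definition search : stmt :=
  (aD @@[#0] ::= #0 ;; rDl ::= #0 ;; rF ::= #0 ;; rFz ::= #1) ;;
  Loop ($rF == #0) diagonal.

Definition pick : stmt :=
  Ite (aD @[$rS * $rr + $rk] < $rInf) (rCur ::= aPtr @[$rS * $rr + $rk]) Nop.

Definition emit : stmt :=
  raw @@[$rS - #1 - $rI] ::= aChr @[$rCur] ;; rCur ::= aPar @[$rCur].

Definition output : stmt :=
  For rk rr pick ;; For rI rS emit ;; (rm ::= $rS ;; rn ::= #0).

Section Search.
Variables (M W : nat) (A B P : seq nat).
Notation m := (size A).
Notation n := (size B).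
Notation r := (size P).
Notation N := (m + n + r).
Notation w := (size (common_chars A B) + 1).
Notation runs := (runs N M W).
Variable Zopt : seq nat.
Notation L := (size Zopt).
Hypothesis r_pos : 0 < r.
Hypothesis Zopt_max : str_ec_lcs A B P Zopt.
Hypothesis M_N : N + 2 < M.
Hypothesis M_nxt : (n + 2) * w <= M.
Hypothesis M_dfa : (m + 1) * r <= M.
Hypothesis M_nodes : (m - L + 1) * ((L + 1) * r) + 1 < M.
Hypothesis W_large : 4 * M <= W.

Variables (id cid : nat -> nat).
Hypothesis id_lt : forall i, i < N -> id i < N.
Hypothesis col_lt : forall i, i < m -> cid (id i) < w.

Record env (s : hst) : Prop := {
  env_m : hv s rm = m;
  env_n : hv s rn = n;
  env_r : hv s rr = r;
  env_inf : hv s rInf = n.+1;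
  env_w : hv s rW = w;
  env_id : ha s aId = id;
  env_cid : ha s aCid = cid;
  env_raw : forall i, i < m -> ha s raw i = nth 0 A i;
  env_nxt : forall i j, i < m -> j < n + 2 ->
    ha s aNxt (j * w + cid (id i)) = next_end B j (nth 0 A i);
  env_dfa : forall k i, k < r -> i < m -> dfa_ok A P (ha s aDfa) k i }.

Lemma env_agree vs aa s s' : agree vs aa s s' ->
  all (fun x => x \notin vs) [:: rm; rn; rr; rInf; rW] ->
  all (fun a => a \notin aa) [:: aId; aCid; raw; aNxt; aDfa] ->
  env s -> env s'.
Proof.
move=> [Av Aa] /= /and5P[? ? ? ?] /andP[? _] /and5P[? ? ? ?] /andP[? _] [] *.
by split; rewrite ?Av ?Aa.
Qed.

Lemma cell_lt s k : s <= m -> k < r -> s * r + k < (m + 1) * r.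
Proof. by move=> *; apply: ltn_cell => //; lia. Qed.

Lemma relax_runs h s i k
    (v := ha h aD (s.-1 * r + k)) (u := next_end B v (nth 0 A i))
    (k2 := ha h aDfa (k * m + i)) (d := ha h aD (s * r + k)) :
  env h -> hv h rS = s -> hv h rI = i -> hv h rk = k ->
  0 < s <= m -> i < m -> k < r -> v <= n.+1 -> hv h rFz + 1 < M ->
  runs relax h (scost relax) (fun h' =>
    if (k2 < r) && (u < ha h aD (s * r + k2))
    then [/\ hv h' rF = 1, hv h' rFz = (hv h rFz).+1,
             ha h' aD = upd (ha h aD) (s * r + k2) u,
             ha h' aPtr = upd (ha h aPtr) (s * r + k2) (hv h rFz)
           & ha h' aChr = upd (ha h aChr) (hv h rFz) (nth 0 A i) /\
             ha h' aPar = upd (ha h aPar) (hv h rFz) (ha h aPtr (s.-1 * r + k))]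
    else ha h' = ha h /\ hv h' rFz = hv h rFz /\
         hv h' rF = if d < n.+1 then 1 else hv h rF).
Proof.
move=> [Em En Er Einf Ew Eid Ecid Eraw Enxt Edfa] Es Ei Ek sm im kr vn fzM.
have lt1 : s.-1 * r + k < (m + 1) * r by apply: cell_lt => //; lia.
have lt2 : s * r + k < (m + 1) * r by apply: cell_lt => //; lia.
have lt3 : v * w + cid (id i) < (n + 2) * w.
  by apply: ltn_cell; [lia | apply: col_lt].
have lt4 : k * m + i < r * m by apply: ltn_cell.
have mr : r * m <= M by lia.
have lti : id i < N by apply: id_lt; lia.
have E1 : s - 1 = s.-1 by lia.
apply: runs_then; apply: runs_asg.
  by rewrite /= /okix /= ?Es ?Er ?Ek ?E1; repeat split; lia.
rewrite (_ : ev _ _ = v); last by rewrite /= Es Er Ek E1.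
apply: runs_then; apply: runs_asg.
  by rewrite /= /okix /= ?Ew ?Ecid ?Eid ?Ei; repeat split; lia.
rewrite (_ : ev _ _ = u); last by rewrite /= Ew Ecid Eid Ei Enxt //; lia.
apply: runs_then; apply: runs_asg.
  by rewrite /= /okix /= ?Ek ?Em ?Ei; repeat split; lia.
rewrite (_ : ev _ _ = k2); last by rewrite /= Ek Em Ei.
apply: runs_then; apply: (@runs_weaken _ _ _ _ _ _ _ (fun h' =>
  ha h' = ha h /\ hv h' rF = if d < n.+1 then 1 else hv h rF)); [| exact: leqnn |].
  apply: runs_ite; rewrite /= /okix /= ?Es ?Er ?Ek ?Einf; first by repeat split; lia.
    by move=> lt; apply: runs_asg => //=; split=> //; case: ifP lt.
  by move=> lt; apply: runs_nop => //=; split=> //; rewrite /d; case: ifP lt.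
move=> h1 A1 [Ha1 EF1].
have [Es1 Er1 Ek1 Ei1] : [/\ hv h1 rS = s, hv h1 rr = r, hv h1 rk = k & hv h1 rI = i].
  by rewrite !A1.1.
have [Eu1 Ek21 Efz1] : [/\ hv h1 rU = u, hv h1 rK2 = k2 & hv h1 rFz = hv h rFz].
  by rewrite !A1.1.
apply: runs_ite => //=; rewrite Ek21 Er1.
  case: ltnP => // k2r _ /=.
  have lt5 : s * r + k2 < (m + 1) * r by apply: cell_lt => //; lia.
  apply: runs_ite; rewrite /= /okix /= ?Es1 ?Er1 ?Ek21 ?Eu1 ?Ha1;
      first by repeat split; lia.
    move=> lt; have -> : u < ha h aD (s * r + k2) by case: (_ < _) lt.
    apply: runs_then; apply: runs_sto; rewrite /= /okix /= ?Es1 ?Er1 ?Ek21 ?Eu1 ?Ha1;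
        try by repeat split; lia.
    apply: runs_then; apply: runs_sto; rewrite /= /okix /= ?Efz1 ?Ei1;
        try by repeat split; lia.
    apply: runs_then; apply: runs_sto;
        rewrite /= /okix /= ?Efz1 ?Es1 ?Er1 ?Ek1 ?E1 ?Ha1; try by repeat split; lia.
    apply: runs_then; apply: runs_sto;
        rewrite /= /okix /= ?Efz1 ?Es1 ?Er1 ?Ek21 ?Ha1; try by repeat split; lia.
    apply: runs_then; apply: runs_asg; rewrite /= ?Efz1; first by repeat split; lia.
    apply: runs_asg => //=.
    by rewrite addn1 Eraw.
  by move=> lt; apply: runs_nop; rewrite ifN //; case: (_ < _) lt.
by case: ltnP => // k2r _; apply: runs_nop.
Qed.

Fixpoint rep fz (ch par : nat -> nat) p (Y : seq nat) : Prop :=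
  if Y is a :: Y' then [/\ p < fz, ch p = a & rep fz ch par (par p) Y']
  else True.

Lemma rep_fresh fz ch par p Y a q : rep fz ch par p Y ->
  rep fz.+1 (upd ch fz a) (upd par fz q) p Y.
Proof.
elim: Y p => //= b Y IH p [lt <- R]; rewrite !ltn_eqF //.
by split; [lia | | apply: IH].
Qed.

(* [Z] realises a cell and is stored backwards in the list of that cell. *)
Definition entry (h : hst) e s k Z : Prop :=
  [/\ [/\ size Z = s, subseq Z (take e A)
       & subseq Z (take (ha h aD (s * r + k)) B)],
      ~~ infix P Z, border P Z = k
    & rep (hv h rFz) (ha h aChr) (ha h aPar) (ha h aPtr (s * r + k)) (rev Z)].

Definition sound h e s : Prop :=
  forall k, k < r -> ha h aD (s * r + k) <= n -> exists Z, entry h e s k Z.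

Definition complete h e s : Prop :=
  forall Z j, size Z = s -> subseq Z (take e A) -> j <= n ->
    subseq Z (take j B) -> ~~ infix P Z -> ha h aD (s * r + border P Z) <= j.

Definition finite h s : Prop := exists2 k, k < r & ha h aD (s * r + k) <= n.

Definition bounded h : Prop :=
  forall a, a < (m + 1) * r -> ha h aD a <= n.+1.

Lemma sound_widen h e e' s : e <= e' -> sound h e s -> sound h e' s.
Proof.
move=> le S k kr kn; have [Z [[sz sA sB] nP bk R]] := S k kr kn.
by exists Z; split=> //; split=> //; apply: subseq_takeW sA.
Qed.

(* Row [s] while its states [< k] have been extended by the character [i] of
   [A]; [h0] is the state before the first extension. *)
Record relaxing (E : nat -> nat) h0 s i k h : Prop := {
  rlx_sound : forall s', s' <= m -> s' <> s -> sound h (E s') s';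
  rlx_complete : forall s', s' <= m -> s' <> s -> complete h (E s') s';
  rlx_row : sound h i.+1 s;
  rlx_old : complete h i s;
  rlx_new : forall Z j, size Z = s.-1 -> subseq Z (take i A) -> border P Z < k ->
    ~~ infix P (rcons Z (nth 0 A i)) -> j <= n ->
    subseq (rcons Z (nth 0 A i)) (take j B) ->
    ha h aD (s * r + border P (rcons Z (nth 0 A i))) <= j;
  rlx_bounded : bounded h;
  rlx_F1 : hv h rF <= 1;
  rlx_finite : hv h rF <> 0 -> finite h s;
  rlx_inf : hv h rF = 0 -> ha h aD = ha h0 aD /\
    forall k', k' < k -> n < ha h0 aD (s * r + k');
  rlx_fz : hv h rFz <= hv h0 rFz + k }.

Lemma border_subset Z e : subseq Z (take e A) ->
  {subset take (border P Z) P <= A}.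
Proof.
move=> sA a aP; apply: (mem_take (n0 := e)); apply: (mem_subseq sA).
by have /suffixP[Y ->] := border_suffix P Z; rewrite mem_cat aP orbT.
Qed.

Lemma relaxing_step E h0 s i k h h'
    (v := ha h aD (s.-1 * r + k)) (u := next_end B v (nth 0 A i))
    (k2 := ha h aDfa (k * m + i)) (d := ha h aD (s * r + k)) :
  0 < s <= m -> i < m -> k < r -> E s.-1 = i -> dfa_ok A P (ha h aDfa) k i ->
  (if (k2 < r) && (u < ha h aD (s * r + k2))
   then [/\ hv h' rF = 1, hv h' rFz = (hv h rFz).+1,
            ha h' aD = upd (ha h aD) (s * r + k2) u,
            ha h' aPtr = upd (ha h aPtr) (s * r + k2) (hv h rFz)
          & ha h' aChr = upd (ha h aChr) (hv h rFz) (nth 0 A i) /\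
            ha h' aPar = upd (ha h aPar) (hv h rFz) (ha h aPtr (s.-1 * r + k))]
   else ha h' = ha h /\ hv h' rFz = hv h rFz /\
        hv h' rF = if d < n.+1 then 1 else hv h rF) ->
  relaxing E h0 s i k h -> relaxing E h0 s i k.+1 h'.
Proof.
move=> sm im kr Es [_ Hdfa] post [I1 I2 I3 I4 I5 I6 I7 I8 I9 I10].
have s1m : s.-1 <= m by lia.
have s1s : s.-1 <> s by lia.
have S1 := I1 _ s1m s1s; have C1 := I2 _ s1m s1s; rewrite Es in S1 C1.
(* Extending through state [k] is at least as good as any string in that state. *)
have new Z j : size Z = s.-1 -> subseq Z (take i A) -> border P Z = k ->
    ~~ infix P (rcons Z (nth 0 A i)) -> j <= n ->
    subseq (rcons Z (nth 0 A i)) (take j B) ->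
    [/\ border P (rcons Z (nth 0 A i)) = k2, k2 < r & u <= j].
  move=> sz sA bk nP jn sB.
  have Ek2 : border P (rcons Z (nth 0 A i)) = k2.
    by rewrite border_step bk /k2 Hdfa // -bk; apply: border_subset sA.
  split=> //; first by rewrite -Ek2 border_excl.
  have [j' lt [Ej sB']] := subseq_rcons_split jn sB.
  have nP' : ~~ infix P Z by move: nP; rewrite infix_rcons_border => /andP[].
  have j'n : j' < n by exact: leq_trans lt jn.
  have vj : v <= j' by rewrite /v -bk; apply: C1 => //; apply: ltnW.
  by apply: leq_trans lt; rewrite /u -Ej; apply: next_end_min.
have Hnew h1 : (forall c, ha h1 aD c <= ha h aD c) ->
    (k2 < r -> ha h1 aD (s * r + k2) <= u) ->
  forall Z j, size Z = s.-1 -> subseq Z (take i A) -> border P Z < k.+1 ->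
    ~~ infix P (rcons Z (nth 0 A i)) -> j <= n ->
    subseq (rcons Z (nth 0 A i)) (take j B) ->
    ha h1 aD (s * r + border P (rcons Z (nth 0 A i))) <= j.
  move=> mono le Z j sz sA; rewrite ltnS leq_eqVlt => /orP[/eqP bk|bk] nP jn sB.
    have [-> k2r uj] := new Z j sz sA bk nP jn sB.
    exact: leq_trans (le k2r) uj.
  by apply: leq_trans (mono _) _; apply: I5.
move: post; case: ifP => [/andP[k2r lt]|/negbT nlt].
  case=> [EF Efz ED Eptr [Echr Epar]].
  have dn : ha h aD (s * r + k2) <= n.+1 by apply: I6; apply: cell_lt => //; lia.
  have un : u <= n by lia.
  have [vu _] := next_endP un.
  have vn : v <= n by rewrite -/u in vu; lia.
  have [Z0 [[sz0 sA0 sB0] nP0 b0 R0]] := S1 k kr vn.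
  have Ek2 : border P (rcons Z0 (nth 0 A i)) = k2.
    by rewrite border_step b0 /k2 Hdfa // -b0; apply: border_subset sA0.
  have keep e s' k' Z : ((s' == s) && (k' == k2)) = false -> k' < r ->
      entry h e s' k' Z -> entry h' e s' k' Z.
    move=> ne k'r [[sz sA sB] nP bk R].
    by rewrite /entry ED Eptr /= eq_cell // ne Efz Echr Epar; split=> //;
      apply: rep_fresh.
  have mono c : ha h' aD c <= ha h aD c.
    by rewrite ED /=; case: eqP => // ->; apply: ltnW.
  split.
  - move=> s' s'm ne k' k'r; rewrite ED /= eq_cell // (introF eqP ne) /= => kn.
    have [Z HZ] := I1 s' s'm ne k' k'r kn; exists Z; apply: keep => //.
    by rewrite (introF eqP ne).
  - move=> s' s'm ne Z j *; apply: leq_trans (mono _) _; exact: I2.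
  - move=> k' k'r; case: (k' =P k2) => [->|ne].
      move=> _; exists (rcons Z0 (nth 0 A i)).
      split=> //.
      + rewrite size_rcons sz0 ED /= eqxx; split; first by lia.
          by apply: subseq_rcons_take => //; lia.
        exact: next_end_subseq.
      + by rewrite infix_rcons_border nP0 Ek2.
      + rewrite rev_rcons Eptr Efz Echr Epar /= !eqxx; split=> //.
        exact: rep_fresh.
    rewrite ED /= eq_cell // (introF eqP ne) andbF => kn.
    have [Z HZ] := I3 k' k'r kn; exists Z; apply: keep => //.
    by rewrite (introF eqP ne) andbF.
  - move=> Z j *; apply: leq_trans (mono _) _; exact: I4.
  - by apply: Hnew => // _; rewrite ED /= eqxx.
  - by move=> a alt; apply: leq_trans (mono _) _; apply: I6.
  - by rewrite EF.
  - by move=> _; exists k2 => //; rewrite ED /= eqxx.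
  - by rewrite EF.
  - by rewrite Efz; lia.
case=> [Eha [Efz EF]].
have kept e s' : sound h e s' -> sound h' e s'.
  by rewrite /sound /entry Eha Efz.
split; rewrite /complete ?Eha ?Efz.
- by move=> s' s'm ne; apply: kept; apply: I1.
- exact: I2.
- exact: kept.
- exact: I4.
- rewrite -Eha; apply: Hnew => [c|k2r]; rewrite Eha //.
  by move: nlt; rewrite k2r /= -leqNgt.
- by rewrite /bounded Eha.
- by rewrite EF; case: ifP.
- rewrite EF /finite Eha; case: ifP => [dn _|_ /I8] //.
  by exists k.
- rewrite EF /d; case: ltnP => // dn /I9[ED H]; split=> // k'.
  rewrite ltnS leq_eqVlt => /orP[/eqP ->|]; last exact: H.
  by rewrite -ED.
- by lia.
Qed.

Lemma relaxing_done E h0 s i h : 0 < s <= m -> i < m ->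
  relaxing E h0 s i r h -> complete h i.+1 s.
Proof.
move=> sm im I Z j sz; rewrite (take_nth 0) //.
case/lastP: Z sz => [|Z a]; first by move=> /=; lia.
rewrite size_rcons subseq_rcons2; case: eqP => [->|ne] sz sA jn sB nP.
  apply: (rlx_new I) => //; first by lia.
  by apply: border_excl; move: nP; rewrite infix_rcons_border => /andP[].
by apply: (rlx_old I) => //; rewrite size_rcons.
Qed.

(* Length of the prefix of [A] that row [s'] accounts for, once the rows up to
   [s] of diagonal [dl] have been updated. *)
Definition prefix_of dl s s' := dl + s' - (s < s').

Definition rows h dl s : Prop := forall s', s' <= m ->
  sound h (prefix_of dl s s') s' /\ complete h (prefix_of dl s s') s'.

Definition row_cost : nat :=
  scost (rI ::= $rDl + $rS ;; rS ::= $rS + #1 ;; rF ::= #0) +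
  (r * (scost relax + 8) + 6).

Lemma dp_row_runs h dl s : env h -> hv h rDl = dl -> hv h rS = s ->
  dl + s < m -> rows h dl s -> bounded h -> hv h rFz + r < M ->
  runs dp_row h row_cost (fun h' =>
    [/\ hv h' rS = s.+1, rows h' dl s.+1, bounded h', hv h' rF <= 1 &
      [/\ hv h' rF <> 0 -> finite h' s.+1,
          hv h' rF = 0 -> forall k, k < r -> n < ha h' aD (s.+1 * r + k)
        & hv h' rFz <= hv h rFz + r]]).
Proof.
move=> Eh Edl Es lt R bd fz; pose i := dl + s.
apply: runs_sq; apply: runs_then; apply: runs_asg.
  by rewrite /= Edl Es; repeat split; lia.
rewrite (_ : ev _ _ = i); last by rewrite /= Edl Es.
apply: runs_then; apply: runs_asg; first by rewrite /= Es; repeat split; lia.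
rewrite (_ : ev _ _ = s.+1); last by rewrite /= Es addn1.
apply: runs_asg => //; set h0 := setv _ _ _ => A0.
have Eh0 : env h0 by apply: env_agree A0 _ _ Eh.
pose E := prefix_of dl s.
have E1 : E s = i by rewrite /E /prefix_of ltnn subn0.
have E2 : E s.+1 = i by rewrite /E /prefix_of ltnSn /i; lia.
have E3 s' : s' <> s.+1 -> prefix_of dl s.+1 s' = E s'.
  by move=> ne; rewrite /E /prefix_of; congr (_ - nat_of_bool _); lia.
have E4 : prefix_of dl s.+1 s.+1 = i.+1 by rewrite /prefix_of ltnn subn0 /i; lia.
have sm : 0 < s.+1 <= m by lia.
have im : i < m by [].
apply: (runs_for (I := relaxing E h0 s.+1 i)) => //.
- exact: env_r Eh0.
- by lia.
- split=> //=; try by move=> s' s'm _; have [] := R s' s'm.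
  + have [S _] := R s.+1 (proj2 (andP sm)); apply: sound_widen S.
    by rewrite -/(E s.+1) E2.
  + by have [_] := R s.+1 (proj2 (andP sm)); rewrite -/(E s.+1) E2.
  + by rewrite addn0.
- move=> k h1 kr A1 Ek I.
  have Eh1 : env h1 by apply: env_agree A1 _ _ Eh0.
  have ES1 : hv h1 rS = s.+1 by rewrite A1.1.
  have EI1 : hv h1 rI = i by rewrite A1.1.
  have vn : ha h1 aD (s.+1.-1 * r + k) <= n.+1.
    by apply: (rlx_bounded I); apply: cell_lt => //=; lia.
  have fz1 : hv h1 rFz + 1 < M.
    by have := rlx_fz I; rewrite /=; lia.
  apply: runs_weaken (relax_runs Eh1 ES1 EI1 Ek sm im kr vn fz1) (leqnn _) _.
  move=> h2 A2 post.
  have I2 := relaxing_step sm im kr E1 (env_dfa Eh1 kr im) post I.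
  by case: I2 => *; split.
- move=> h1 A1 I; have C := relaxing_done sm im I.
  split.
  + by rewrite A1.1.
  + move=> s' s'm; case: (s' =P s.+1) => [->|ne].
      by rewrite E4; split=> //; apply: rlx_row I.
    by rewrite E3 //; split; [apply: (rlx_sound I) | apply: (rlx_complete I)].
  + exact: rlx_bounded I.
  + exact: rlx_F1 I.
  + split; first exact: rlx_finite I.
      by move=> /(rlx_inf I)[-> H] k kr; apply: H.
    exact: rlx_fz I.
Qed.

Lemma sound_excl h s e : sound h e s -> finite h s ->
  exists2 Z, excl_common_subseq A B P Z & size Z = s.
Proof.
move=> S [k kr kn]; have [Z [[sz sA sB] nP _ _]] := S k kr kn.
exists Z => //; rewrite /excl_common_subseq nP andbT.
by rewrite (subseq_trans sA (take_subseq _ _)) (subseq_trans sB (take_subseq _ _)).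
Qed.

Lemma finite_le h s e : sound h e s -> finite h s -> s <= L.
Proof.
move=> S F; have [Z HZ <-] := sound_excl S F.
by have [_ H] := Zopt_max; apply: H.
Qed.

Lemma infinite_row h dl s Z : complete h (dl + s) s ->
  (forall k, k < r -> n < ha h aD (s * r + k)) ->
  ~~ infix P Z -> subseq Z B -> s <= size Z ->
  subseq Z (take (dl + size Z) A) -> False.
Proof.
move=> C inf nP sB sz sA.
have nP' : ~~ infix P (take s Z).
  apply: contra nP => H; apply: (infix_trans H).
  by rewrite -{2}(cat_take_drop s Z) prefixW // prefix_prefix.
have sB' : subseq (take s Z) (take n B).
  by rewrite take_size; apply: subseq_trans sB; apply: take_subseq.
have := C _ n (size_takel sz) (subseq_take_take sz sA) (leqnn _) sB' nP'.
by rewrite leqNgt inf // border_excl.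
Qed.

Lemma infix_nil : ~~ infix P [::].
Proof. by rewrite infixs0; case: (P) r_pos. Qed.

Lemma row0_any h e e' : sound h e 0 -> complete h e 0 ->
  sound h e' 0 /\ complete h e' 0.
Proof.
move=> S C; split.
  move=> k kr kn; have [Z [[/size0nil -> _ sB] nP bk R]] := S k kr kn.
  by exists [::]; split=> //; split=> //; apply: sub0seq.
by move=> Z j /size0nil -> _ jn _ nP; apply: C; rewrite ?sub0seq.
Qed.

Definition found h s : Prop :=
  [/\ s <= m, finite h s, sound h m s, hv h rFz <= M
    & forall Z, excl_common_subseq A B P Z -> size Z <= s].

Notation loop_guard := ($rF * ($rDl + $rS < $rm))%expr.

Definition diagonal_cost : nat :=
  scost (rS ::= #0 ;; rF ::= #1) +
  ((L.+1 * (row_cost + ecost loop_guard).+1 + (ecost loop_guard + 1)) +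
   scost (rDl ::= $rDl + #1)).

Definition searching h dl : Prop :=
  [/\ rows h dl 0, bounded h,
      forall Z, excl_common_subseq A B P Z -> size Z + dl <= m
    & hv h rFz <= 1 + dl * ((L + 1) * r)].

Lemma diagonal_runs h dl : env h -> hv h rDl = dl -> searching h dl ->
  runs diagonal h diagonal_cost (fun h' =>
    [/\ hv h' rDl = dl.+1,
        hv h' rF = 0 -> searching h' dl.+1
      & hv h' rF <> 0 -> found h' (hv h' rS)]).
Proof.
move=> Eh Edl [R bd short fz].
have Lm : L + dl <= m by apply: short; case: Zopt_max.
apply: runs_sq; apply: runs_then; apply: runs_asg => //; apply: runs_asg => //.
set h0 := setv _ _ _ => A0.
have Eh0 : env h0 by apply: env_agree A0 _ _ Eh.
pose J k h' := let s := hv h' rS in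
  [/\ k + s = L.+1, dl + s <= m, rows h' dl s, bounded h' & [/\ hv h' rF <= 1,
    hv h' rF <> 0 -> finite h' s,
    hv h' rF = 0 -> forall k, k < r -> n < ha h' aD (s * r + k)
    & hv h' rFz <= 1 + dl * ((L + 1) * r) + s * r]].
apply: runs_sq; apply: (runs_loop (I := J)).
- split=> //=; try by lia.
  split=> //; last by rewrite mul0n addn0.
  move=> _; exists 0 => //; have [_ C] := R 0 isT.
  have := C [::] 0; rewrite border_nil !sub0seq => H.
  by apply: leq_trans (H _ _ _ _ infix_nil) _.
- move=> k h' [_ sm _ _ [F1 _ _ _]] A1; rewrite /= (A1.1 rDl) //= Edl.
  by repeat split=> //=; [lia | apply: leq_ltn_trans (leq_mul F1 (leq_b1 _)) _; lia].
- move=> k h' [ks sm R' bd' [F1 fin inf fz']] A1 /=.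
  have Eh' : env h' by apply: env_agree A1 _ _ Eh0.
  have Edl' : hv h' rDl = dl by rewrite A1.1.
  rewrite muln_eq0 negb_or Edl' (env_m Eh') => /andP[/eqP Fnz lt].
  have {}lt : dl + hv h' rS < m by case: ltnP lt.
  have [S _] := R' (hv h' rS) ltac:(lia).
  have sL := finite_le S (fin Fnz).
  have fzM : hv h' rFz + r < M.
    apply: leq_ltn_trans M_nodes.
    have : dl * ((L + 1) * r) <= (m - L) * ((L + 1) * r) by rewrite leq_mul2r; lia.
    have : (hv h' rS + 1) * r <= (L + 1) * r by rewrite leq_mul2r; lia.
    by rewrite mulnDl !mul1n [(m - L + 1) * _]mulnDl mul1n; lia.
  apply: runs_weaken (dp_row_runs Eh' Edl' erefl lt R' bd' fzM) (leqnn _) _.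
  move=> h2 A2 [ES R2 bd2 F2 [fin2 inf2 fz2]] _; exists k.-1; first by lia.
  rewrite /J ES; split=> //; try by lia.
  by split=> //; rewrite mulSn; lia.
- move=> k h' [ks sm R' bd' [F1 fin inf fz']] A1 /=.
  have Eh' : env h' by apply: env_agree A1 _ _ Eh0.
  have Edl' : hv h' rDl = dl by rewrite A1.1.
  set s := hv h' rS in ks sm R' fin inf fz' *.
  rewrite Edl' (env_m Eh') => stop _; apply: runs_asg.
    by rewrite /= Edl'; repeat split; lia.
  have [S C] := R' s ltac:(lia).
  have Es : prefix_of dl s s = dl + s by rewrite /prefix_of ltnn subn0.
  rewrite Es in S C.
  split; first by rewrite /= Edl' addn1.
    move=> /= F0; have none Z := @infinite_row h' dl s Z C (inf F0).
    split=> //=.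
    + move=> s' s'm; case: (posnP s') => [->|s'pos].
        by have [S0 C0] := R' 0 isT; apply: row0_any S0 C0.
      have -> : prefix_of dl.+1 0 s' = dl + s' by rewrite /prefix_of s'pos; lia.
      have [S' C'] := R' s' s'm; case: (leqP s' s) => le.
        by move: S' C'; rewrite /prefix_of ltnNge le /= subn0.
      split; first by apply: sound_widen S'; rewrite /prefix_of; lia.
      move=> Z j sz sA jn sB nP; case: (none Z) => //.
      * exact: subseq_trans sB (take_subseq _ _).
      * by rewrite sz; apply: ltnW.
      * by rewrite sz.
    + move=> Z HZ; have le := short Z HZ; have /and3P[sA sB nP] := HZ.
      rewrite addnS ltn_neqAle le andbT; apply/eqP => E.
      apply: (none Z) => //; first by rewrite -(leq_add2r dl) E addnC.
      by rewrite addnC E take_size.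
    + have sL : s * r <= (L + 1) * r by rewrite leq_mul2r; lia.
      by rewrite mulSn; lia.
  move=> /= Fnz; have Em : dl + s = m.
    move/eqP: stop; rewrite muln_eq0; case: eqP => // _ /=.
    by case: ltnP => // ? _; lia.
  have sL := finite_le S (fin Fnz).
  rewrite Em in S; split=> //=; [by lia | exact: fin | | by move=> Z /short; lia].
  have : dl * ((L + 1) * r) <= (m - L) * ((L + 1) * r) by rewrite leq_mul2r; lia.
  have : s * r <= (L + 1) * r by rewrite leq_mul2r; lia.
  by move: M_nodes; rewrite [(m - L + 1) * _]mulnDl mul1n; lia.
Qed.

Definition search_cost : nat :=
  scost (aD @@[#0] ::= #0 ;; rDl ::= #0 ;; rF ::= #0 ;; rFz ::= #1) +
  ((m - L).+1 * (diagonal_cost + ecost ($rF == #0)).+1 +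
   (ecost ($rF == #0) + 1)).

Lemma search_runs h : env h -> (forall a, a < (m + 1) * r -> ha h aD a = n.+1) ->
  runs search h search_cost (fun h' => found h' (hv h' rS)).
Proof.
move=> Eh HD.
apply: runs_sq; apply: runs_then; apply: runs_sto; rewrite //= /okix /=; first by lia.
apply: runs_then; apply: runs_asg => //.
apply: runs_then; apply: runs_asg => //; apply: runs_asg => //.
set h0 := setv _ _ _ => A0.
have Eh0 : env h0 by apply: env_agree A0 _ _ Eh.
have mr : 0 < (m + 1) * r by rewrite muln_gt0 r_pos addn1.
have S0 : searching h0 0.
  split=> //.
  - move=> s' s'm; case: (posnP s') => [->|s'pos].
      split=> [k kr|Z j /size0nil -> _ _ _ _] /=; last by rewrite border_nil.
      rewrite mul0n add0n; case: (k =P 0) => [-> _|kne].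
        exists [::]; split; rewrite ?border_nil ?infix_nil ?sub0seq //.
      rewrite HD ?ltnn //; apply: leq_trans kr _.
      by rewrite -{1}[r]mul1n leq_mul2r addn1 orbT.
    have neq k : (s' * r + k == 0) = false.
      by rewrite gtn_eqF // addn_gt0 muln_gt0 s'pos r_pos.
    split=> [k kr|Z j sz sA].
      by rewrite /= neq HD ?ltnn //; apply: cell_lt.
    have := size_subseq sA; rewrite sz /prefix_of s'pos size_take.
    by case: ltnP; lia.
  - by move=> a alt /=; case: eqP => // _; rewrite HD.
  - by move=> Z /and3P[sA _ _]; rewrite addn0; apply: size_subseq.
pose I k h' := (hv h' rF = 0 ->
    k + hv h' rDl = (m - L).+1 /\ searching h' (hv h' rDl)) /\
  (hv h' rF <> 0 -> found h' (hv h' rS)).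
apply: (runs_loop (I := I)) => //.
- by split=> // _; rewrite addn0.
- move=> k h' [I0 _] A1 /=; rewrite eqb0 negbK => /eqP F0.
  have Eh' : env h' by apply: env_agree A1 _ _ Eh0.
  have [ks Sg] := I0 F0.
  have Ldl : L + hv h' rDl <= m by have [_ _ H _] := Sg; apply: H; case: Zopt_max.
  apply: runs_weaken (diagonal_runs Eh' erefl Sg) (leqnn _) _.
  move=> h2 A2 [Edl H0 H1] _; exists k.-1; first by lia.
  split=> // F2; rewrite Edl; split; [by lia | exact: H0].
- move=> k h' [_ I1] A1 /= /eqP; rewrite eqb0 => /eqP F; exact: I1.
Qed.

Definition output_cost : nat :=
  (r * (scost pick + 8) + 6) +
  ((m * (scost emit + 8) + 6) + scost (rm ::= $rS ;; rn ::= #0)).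

Lemma output_runs h s : env h -> found h (hv h rS) -> hv h rS = s ->
  runs output h output_cost (fun h' =>
    exists Z, [/\ str_ec_lcs A B P Z, hv h' rm = size Z, hv h' rn = 0,
      size Z <= m & forall i, i < size Z -> ha h' raw i = nth 0 Z i]).
Proof.
move=> Eh fnd Es; rewrite Es in fnd; have [sm [k0 k0r k0n] S fzM opt] := fnd.
pose I k h' := (exists2 k', k' < k & ha h aD (s * r + k') <= n) ->
  exists k', [/\ k' < r, ha h aD (s * r + k') <= n
    & hv h' rCur = ha h aPtr (s * r + k')].
apply: runs_sq; apply: (runs_for (I := I)) => //.
- exact: env_r Eh.
- by lia.
- by case.
- move=> k h1 kr A1 Ek IH.
  have Eh1 : env h1 by apply: env_agree A1 _ _ Eh.
  have Es1 : hv h1 rS = s by rewrite A1.1.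
  have lt := cell_lt sm kr.
  have [ED EP] : ha h1 aD = ha h aD /\ ha h1 aPtr = ha h aPtr by rewrite !A1.2.
  apply: runs_ite; rewrite /= /okix /= ?Es1 ?(env_r Eh1) ?(env_inf Eh1) ?Ek ?ED;
      first by repeat split; lia.
    move=> kn; apply: runs_asg; rewrite /= /okix /= ?Es1 ?(env_r Eh1) ?Ek ?EP;
        first by repeat split; lia.
    move=> _; exists k; split=> //.
    by rewrite -ltnS; case: (_ < _) kn.
  move=> kn; apply: runs_nop => -[k' lt' k'n]; apply: IH; exists k' => //.
  move: lt'; rewrite ltnS leq_eqVlt => /orP[/eqP E|//].
  by rewrite E in k'n; rewrite ltnS k'n in kn.
move=> h1 A1 H1 _; have [k [kr kn Ecur]] := H1 ltac:(by exists k0).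
have [Z [[sz sA sB] nP bk R]] := S k kr kn.
have Es1 : hv h1 rS = s by rewrite A1.1.
rewrite -Ecur in R.
pose J i h' := rep (hv h rFz) (ha h aChr) (ha h aPar) (hv h' rCur) (drop i (rev Z)) /\
  forall t, s <= t + i -> t < s -> ha h' raw t = nth 0 Z t.
have EQ : s * (scost emit + 8) + 6 <= m * (scost emit + 8) + 6.
  by rewrite leq_add2r leq_mul2r sm orbT.
apply: runs_sq; apply: runs_weaken _ EQ (fun _ _ H => H).
apply: (runs_for (I := J)) => //.
- by lia.
- by split=> /=; [rewrite drop0 | move=> t; lia].
- move=> i h2 lti A2 Ei [R2 H2].
  have Es2 : hv h2 rS = s by rewrite A2.1.
  have [EC EP] : ha h2 aChr = ha h aChr /\ ha h2 aPar = ha h aPar.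
    by rewrite !A2.2 // !A1.2.
  have szr : i < size (rev Z) by rewrite size_rev sz.
  rewrite (drop_nth 0) //= in R2; have [lt Ech R3] := R2.
  apply: runs_then; apply: runs_sto; rewrite /= /okix /= ?Es2 ?Ei;
      try by repeat split; lia.
  apply: runs_asg; rewrite /= /okix /=; first by repeat split; lia.
  rewrite EC EP; split=> //= t st ts; case: eqP => [->|ne].
    rewrite Ech nth_rev ?sz //; congr nth; lia.
  by apply: H2 => //; lia.
move=> h2 A2 [_ H2] A2'; apply: runs_then; apply: runs_asg => //; apply: runs_asg => //.
exists Z; split=> //=.
- split; last by rewrite sz.
  rewrite /excl_common_subseq nP andbT (subseq_trans sA (take_subseq _ _)).
  exact: subseq_trans sB (take_subseq _ _).
- by rewrite A2.1 // Es1 sz.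
- by rewrite sz.
- by move=> i; rewrite sz => ?; apply: H2; lia.
Qed.

End Search.

(** * The whole program and its cost *)

Definition main : stmt := setup ;; rename ;; tables ;; search ;; output.

Definition program : cmd :=
  Seq (Op Add regN rm rn) (Seq (Op Add regN regN rr) (compS main)).

Definition start (A B P : seq nat) : hst :=
  HSt (upd (nth 0 [:: size A; size B; size P]) regN (size A + size B + size P))
      (fun a => if a == raw then nth 0 (A ++ B ++ P) else fun=> 0).

Section Main.
Variables (M W c : nat) (A B P Zopt : seq nat).
Notation m := (size A).
Notation n := (size B).
Notation r := (size P).
Notation N := (m + n + r).
Notation sigma := (size (common_chars A B)).
Notation w := (sigma + 1).
Notation L := (size Zopt).
Notation runs := (runs N M W).
Hypothesis r_pos : 0 < r.
Hypothesis Zopt_max : str_ec_lcs A B P Zopt.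
Hypothesis M_N : N + 2 < M.
Hypothesis M_nxt : (n + 2) * w <= M.
Hypothesis M_dfa : (m + 1) * r <= M.
Hypothesis M_nodes : (m - L + 1) * ((L + 1) * r) + 1 < M.
Hypothesis W_large : 4 * M <= W.
Hypothesis chars : forall x, x \in A ++ B ++ P -> x < N.+1 ^ c.

Let M_N' : N < M. Proof. lia. Qed.
Let W_large' : 2 * M <= W. Proof. lia. Qed.

Definition tables_cost : nat :=
  (n * (scost mark_B + 8) + 6) + ((m * (scost number_A + 8) + 6) +
  (scost (rW ::= $rCnt + #1) + (nxt_cost A B + (dfa_cost A P +
  ((m + 1) * r * (scost (aD @@[$rI] ::= $rInf) + 8) + 6))))).

Lemma tables_runs s : hv s rm = m -> hv s rn = n -> hv s rr = r ->
  hv s rInf = n.+1 -> hv s rRows = n + 2 -> hv s rT = (m + 1) * r ->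
  hv s rCnt = 0 -> hv s rX = 0 ->
  (forall i, ha s raw i = nth 0 (A ++ B ++ P) i) ->
  (forall i, i < N -> ha s aId i < N) ->
  (forall i j, i < N -> j < N ->
     ha s aId i = ha s aId j <-> nth 0 (A ++ B ++ P) i = nth 0 (A ++ B ++ P) j) ->
  (forall a, ha s aMark a = 0) -> (forall a, ha s aCid a = 0) ->
  (forall a, ha s aDfa a = 0) ->
  runs tables s tables_cost (fun s' => exists cid,
    [/\ env A B P (ha s aId) cid s',
        forall i, i < m -> cid (ha s aId i) < w
      & forall a, a < (m + 1) * r -> ha s' aD a = n.+1]).
Proof.
move=> Em En Er Einf Erows ET Ecnt EX Eraw id_lt id_inj Hmark Hcid Hdfa.
apply: runs_sq.
apply: runs_weaken (mark_runs r_pos M_N' M_nxt M_dfa W_large' id_lt id_inj Em En erefl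
    Hmark) (leqnn _) _.
move=> s1 A1 H1 _; apply: runs_sq.
have [Em1 Ecnt1 Eid1 Ecid1] : [/\ hv s1 rm = m, hv s1 rCnt = 0, ha s1 aId = ha s aId &
    ha s1 aCid = ha s aCid].
  by rewrite !A1.1 // !A1.2.
have Hcid1 a : ha s1 aCid a = 0 by rewrite Ecid1.
apply: runs_weaken (number_runs r_pos M_N' M_nxt M_dfa W_large' id_lt id_inj Em1 Ecnt1
    Eid1 Hcid1 H1) (leqnn _) _.
move=> s2 A2 H2 _.
have Ecnt2 : hv s2 rCnt = sigma by have [-> _ _ _] := H2; rewrite take_size.
rewrite Ecnt2 in H2; set cid := ha s2 aCid in H2.
have wn : w * 2 <= M by apply: leq_trans M_nxt; rewrite mulnC leq_mul2r; lia.
apply: runs_sq; apply: runs_asg; first by rewrite /= Ecnt2; repeat split; lia.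
rewrite (_ : ev _ _ = w); last by rewrite /= Ecnt2.
set s3 := setv _ _ _ => _; apply: runs_sq.
have E3v x : x \notin [:: rI; rW; rCnt] -> hv s3 x = hv s x.
  rewrite !inE !negb_or => /and3P[/negPf n1 /negPf n2 /negPf n3].
  by rewrite /= n2 A2.1 ?A1.1 //= !inE ?n1 ?n3.
have E3a a : a \notin [:: aMark; aCid] -> ha s3 a = ha s a.
  rewrite !inE !negb_or => /andP[/negPf n1 /negPf n2].
  by rewrite /= A2.2 ?A1.2 //= !inE ?n1 ?n2.
have ltw i : i < m -> cid (ha s aId i) < w.
  by move=> im; apply: (col_lt H2); lia.
apply: runs_weaken (nxt_runs r_pos M_N' M_nxt M_dfa W_large' id_lt id_inj (s := s3) H2
    _ _ _ _ _ _ _) (leqnn _) _;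
  try by [|rewrite ?E3v ?E3a].
move=> s4 A4 H4 _; apply: runs_sq.
have E4v x : x \notin [:: rI; rW;
    rCnt] ++ wv (For rJ rRows nxt_row) -> hv s4 x = hv s x.
  by rewrite mem_cat negb_or => /andP[? ?]; rewrite A4.1 // E3v.
have E4a a : a \notin [:: aMark; aCid] ++ wa (For rJ rRows nxt_row) -> ha s4 a = ha s a.
  by rewrite mem_cat negb_or => /andP[? ?]; rewrite A4.2 // E3a.
apply: runs_weaken (dfa_runs r_pos M_N' M_nxt M_dfa W_large' (s := s4) _ _ _ _ _ _)
    (leqnn _) _;
  rewrite ?E4v ?E4a //.
move=> s5 A5 H5 _.
apply: runs_weaken (init_runs r_pos M_N' M_nxt M_dfa W_large' (s := s5) _ _) (leqnn _)
    _;
  rewrite ?A5.1 ?E4v //.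
move=> s6 A6 H6; exists cid; split=> //.
have H4' i j : i < m -> j < n + 2 ->
    ha s6 aNxt (j * w + cid (ha s aId i)) = next_end B j (nth 0 A i).
  by move=> im jn; rewrite A6.2 // A5.2 //; apply: H4.
have Ec6 : ha s6 aCid = cid by rewrite A6.2 // A5.2 // A4.2.
have Ew6 : hv s6 rW = w by rewrite A6.1 // A5.1 // A4.1.
have Eraw6 i : i < m -> ha s6 raw i = nth 0 A i.
  by move=> im; rewrite A6.2 // A5.2 // E4a // Eraw nth_cat im.
have Hd6 k i : k < r -> i < m -> dfa_ok A P (ha s6 aDfa) k i.
  by move=> kr im; rewrite A6.2 //; apply: H5.
split=> //; first [by rewrite A6.1 // A5.1 // E4v | by rewrite A6.2 // A5.2 // E4a].
Qed.

Definition main_cost : nat :=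
  scost setup + (rename_cost N c + (tables_cost +
  (search_cost A P Zopt + output_cost A P))).

Lemma main_runs : runs main (start A B P) main_cost (fun s' =>
  exists Z, [/\ str_ec_lcs A B P Z, hv s' rm = size Z, hv s' rn = 0,
      size Z <= m & forall i, i < size Z -> ha s' raw i = nth 0 Z i]).
Proof.
apply: runs_sq.
apply: (@runs_weaken _ _ _ _ _ _ _ (fun s' => [/\ hv s' rK = N.+1,
  hv s' rInf = n.+1, hv s' rRows = n + 2 & hv s' rT = (m + 1) * r]));
  [| exact: leqnn |].
  apply: runs_then; apply: runs_asg; first by rewrite /=; repeat split; lia.
  apply: runs_then; apply: runs_asg; first by rewrite /=; repeat split; lia.
  apply: runs_then; apply: runs_asg; first by rewrite /=; repeat split; lia.
  by apply: runs_asg; rewrite /= ?addn1; repeat split; lia.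
move=> s1 A1 [EK Einf Erows ET] _; apply: runs_sq.
have raw1 i : ha s1 raw i = nth 0 (A ++ B ++ P) i by rewrite A1.2.
have EN1 : hv s1 regN = N by rewrite A1.1.
apply: runs_weaken (@rename_runs N M W c _ _ _ s1 EN1 EK _ _) (leqnn _) _; try lia.
- by move=> i _; rewrite A1.2.
- by move=> i iN; rewrite raw1; apply: chars; rewrite mem_nth // !size_cat addnA.
move=> s2 A2 [id_lt id_inj] _; apply: runs_sq.
have id_inj' i j : i < N -> j < N -> ha s2 aId i = ha s2 aId j <->
    nth 0 (A ++ B ++ P) i = nth 0 (A ++ B ++ P) j.
  by rewrite -!raw1; apply: id_inj.
have Z2 a : a \in [:: aMark; aCid; aDfa] -> ha s2 a = fun=> 0.
  move=> Ha; rewrite A2.2; last by move: Ha; rewrite !inE => /or3P[] /eqP ->.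
  by rewrite A1.2 //=; move: Ha; rewrite !inE => /or3P[] /eqP ->.
apply: runs_weaken (@tables_runs s2 _ _ _ _ _ _ _ _ _ id_lt id_inj' _ _ _) (leqnn _) _;
  try by rewrite ?A2.1 // A1.1.
- by move=> i; rewrite A2.2.
- by move=> a; rewrite Z2.
- by move=> a; rewrite Z2.
- by move=> a; rewrite Z2.
move=> s3 A3 [cid [E3 ltw HD]] _; apply: runs_sq.
apply: runs_weaken (search_runs r_pos Zopt_max M_N M_nxt M_dfa M_nodes W_large id_lt
    ltw E3 HD) (leqnn _) _.
move=> s4 A4 fnd _.
have E4 : env A B P (ha s2 aId) cid s4 by apply: env_agree A4 _ _ E3.
by apply: output_runs E4 fnd erefl; eassumption.
Qed.

End Main.

Lemma str_ec_lcs_exists (A B P : seq nat) : 0 < size P ->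
  exists Z, str_ec_lcs A B P Z.
Proof.
move=> r_pos; pose ok (t : (size A).-tuple bool) := excl_common_subseq A B P (mask t A).
have ok0 : ok [tuple of nseq (size A) false].
  by rewrite /ok /= mask_false /excl_common_subseq !sub0seq infixs0; case: (P) r_pos.
have [t Ht max] := @arg_maxnP _ _ ok (fun t => size (mask t A)) ok0.
exists (mask t A); split=> // Z HZ; have /and3P[/subseqP[u su EZ] _ _] := HZ.
have := max (Tuple (introT eqP su)); rewrite /ok /= -EZ; exact.
Qed.

Section Domination.
Implicit Types (a b k Y : nat).

Lemma dom_add a b Y C D : a <= C * Y -> b <= D * Y -> a + b <= (C + D) * Y.
Proof. by move=> *; rewrite mulnDl leq_add. Qed.

Lemma dom_const k Y : 0 < Y -> k <= k * Y.
Proof. by move=> Y0; rewrite leq_pmulr. Qed.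

Lemma dom_succ a Y C : 0 < Y -> a <= C * Y -> a.+1 <= (C + 1) * Y.
Proof. by move=> *; rewrite -addn1; apply: dom_add => //; apply: dom_const. Qed.

Lemma dom_mul X Y a C D : X <= C * Y -> a <= D -> X * a <= C * D * Y.
Proof. by move=> H1 H2; rewrite -mulnA [D * Y]mulnC mulnA leq_mul. Qed.

Lemma dom_prod X Y a C : a <= C * Y -> X * a <= C * (X * Y).
Proof. by move=> H; rewrite mulnCA leq_mul2l H orbT. Qed.

Lemma dom_trans a X Y C D : a <= C * X -> X <= D * Y -> a <= C * D * Y.
Proof. by move=> H1 H2; apply: leq_trans H1 _; rewrite -mulnA leq_mul2l H2 orbT. Qed.

End Domination.

Lemma rename_bound c : exists C, forall N, rename_cost N c <= C * N.+1.
Proof.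
eexists=> N; rewrite /rename_cost /pass_cost /traverse_cost.
have Y0 : 0 < N.+1 by [].
have N1 : N <= 1 * N.+1 by lia.
have N2 : 2 * N <= 2 * N.+1 by lia.
have K1 : N.+1 <= 1 * N.+1 by lia.
apply: dom_add.
  by apply: dom_add; [apply: (dom_mul N1 (leqnn _)) | apply: dom_const].
apply: dom_add; first exact: dom_const.
apply: dom_add; last exact: dom_const.
rewrite mulnC; apply: (dom_mul _ (leqnn _)).
apply: dom_succ => //; apply: dom_add; last exact: dom_const.
apply: dom_add; first exact: dom_const.
apply: dom_add.
  by apply: dom_add; [apply: (dom_mul K1 (leqnn _)) | apply: dom_const].
apply: dom_add.
  by apply: dom_add; [apply: (dom_mul N1 (leqnn _)) | apply: dom_const].
apply: dom_add; first exact: dom_const.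
apply: dom_add; last exact: dom_const.
exact: (dom_mul N2 (leqnn _)).
Qed.

Lemma search_bound : exists C, forall A P Zopt : seq nat, 0 < size P ->
  search_cost A P Zopt <=
  C * ((size A - size Zopt + 1) * ((size Zopt + 1) * size P)).
Proof.
eexists=> A P Z r0; rewrite /search_cost /diagonal_cost /row_cost.
have Y1 : 0 < (size Z + 1) * size P by rewrite muln_gt0 r0 addn1.
have Y2 : 0 < (size A - size Z + 1) * ((size Z + 1) * size P).
  by rewrite muln_gt0 Y1 addn1.
have r1 : size P <= 1 * size P by rewrite mul1n.
apply: dom_add; first exact: dom_const.
apply: dom_add; last exact: dom_const.
rewrite -[(_ - _).+1]addn1; apply: dom_prod.
apply: dom_succ => //; apply: dom_add; last exact: dom_const.
apply: dom_add; first exact: dom_const.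
apply: dom_add; last exact: dom_const.
apply: dom_add; last exact: dom_const.
rewrite -[(size Z).+1]addn1; apply: dom_prod.
apply: dom_succ => //; apply: dom_add; last exact: dom_const.
apply: dom_add; first exact: dom_const.
by apply: dom_add; [apply: (dom_mul r1 (leqnn _)) | apply: dom_const].
Qed.

Section Quantities.
Variables A B P Z : seq nat.
Notation m := (size A).
Notation n := (size B).
Notation r := (size P).
Notation N := (m + n + r).
Notation sigma := (size (common_chars A B)).
Notation Bd := (ec_lcs_bound A B P (size Z)).
Hypothesis r_pos : 0 < r.
Hypothesis Z_le : size Z <= m.

Lemma sigma_le : sigma <= m.
Proof.
apply: leq_trans (size_undup _) _; rewrite size_filter; exact: count_size.
Qed.

Lemma bound_nodes : (m - size Z + 1) * ((size Z + 1) * r) <= 1 * Bd.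
Proof. by rewrite mul1n /ec_lcs_bound mulnA [(m - _ + 1) * _]mulnC leq_addl. Qed.

Lemma bound_dfa : (m + 1) * r <= 1 * Bd.
Proof.
apply: leq_trans bound_nodes; rewrite mulnA leq_mul2r; apply/orP; right.
by nia.
Qed.

Lemma bound_pos : 0 < Bd.
Proof. by have := bound_dfa; nia. Qed.

Lemma bound_m : m <= 1 * Bd.
Proof. by apply: leq_trans bound_dfa; nia. Qed.

Lemma bound_r : r <= 1 * Bd.
Proof. by apply: leq_trans bound_dfa; nia. Qed.

Lemma bound_n_sigma : n * maxn 1 sigma <= Bd.
Proof. exact: leq_addr. Qed.

Lemma bound_n : n <= 1 * Bd.
Proof.
by rewrite mul1n; apply: leq_trans bound_n_sigma; rewrite leq_pmulr // leq_max.
Qed.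

Lemma bound_N : N.+1 <= 4 * Bd.
Proof. by have := (bound_m, bound_n, bound_r, bound_pos) => -[[[]]]; lia. Qed.

Lemma bound_nxt : (n + 2) * (sigma + 1) <= 6 * Bd.
Proof.
have H1 : n * sigma <= n * maxn 1 sigma by rewrite leq_mul2l leq_max leqnn !orbT.
have {}H1 := leq_trans H1 bound_n_sigma.
have := (bound_m, bound_n, bound_pos, sigma_le) => -[[[]]].
have -> : (n + 2) * (sigma + 1) = n * sigma + n + (2 * sigma + 2).
  by rewrite mulnDl !mulnDr !muln1.
by lia.
Qed.

Lemma bound_pow : Bd <= N.+1 ^ 4.
Proof.
have H1 : n * maxn 1 sigma <= N.+1 * N.+1.
  by apply: leq_mul; [lia | have := sigma_le; lia].
have H2 : (size Z + 1) * (m - size Z + 1) * r <= N.+1 * N.+1 * N.+1.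
  by apply: leq_mul; [apply: leq_mul; lia | lia].
have H3 : 2 <= N.+1 by lia.
apply: (@leq_trans (N.+1 * N.+1 + N.+1 * N.+1 * N.+1)); first exact: leq_add.
rewrite !expnS expn0 muln1 !mulnA; move: H3; generalize (N.+1) => K H3.
nia.
Qed.

End Quantities.

Lemma tables_bound : exists C, forall A B P Z : seq nat,
  0 < size P -> size Z <= size A ->
  tables_cost A B P <= C * ec_lcs_bound A B P (size Z).
Proof.
eexists=> A B P Z r0 Zle; rewrite /tables_cost /nxt_cost /dfa_cost.
have Y0 := bound_pos B r0 Zle.
have n2 : size B + 2 <= 3 * ec_lcs_bound A B P (size Z).
  by have := bound_n A B P Z; lia.
apply: dom_add.
  by apply: dom_add; [apply: (dom_mul (bound_n _ _ _ _) (leqnn _)) | apply: dom_const].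
apply: dom_add.
  by apply: dom_add; [apply: (dom_mul (bound_m _ r0 Zle) (leqnn _)) | apply: dom_const].
apply: dom_add; first exact: dom_const.
apply: dom_add.
  apply: dom_add; last exact: dom_const.
  rewrite mulnDr; apply: dom_add; last exact: (dom_mul n2 (leqnn _)).
  rewrite mulnDr; apply: dom_add; first exact: (dom_mul n2 (leqnn _)).
  rewrite mulnDr; apply: dom_add; last exact: (dom_mul n2 (leqnn _)).
  by rewrite mulnA; apply: (dom_mul (bound_nxt _ r0 Zle) (leqnn _)).
apply: dom_add.
  apply: dom_add; last exact: dom_const.
  rewrite mulnDr; apply: dom_add; last exact: (dom_mul (bound_r _ r0 Zle) (leqnn _)).
  rewrite mulnDr; apply: dom_add; first exact: (dom_mul (bound_r _ r0 Zle) (leqnn _)).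
  rewrite mulnDr; apply: dom_add; last exact: (dom_mul (bound_r _ r0 Zle) (leqnn _)).
  rewrite mulnDr; apply: dom_add; last exact: (dom_mul (bound_r _ r0 Zle) (leqnn _)).
  rewrite mulnA; apply: (dom_mul _ (leqnn _)).
  by apply: leq_trans (bound_dfa _ r0 Zle); rewrite mulnC leq_mul2r; lia.
apply: dom_add; last exact: dom_const.
exact: (dom_mul (bound_dfa _ r0 Zle) (leqnn _)).
Qed.

Lemma main_bound c : exists C, forall A B P Z : seq nat,
  0 < size P -> size Z <= size A ->
  main_cost c A B P Z <= C * ec_lcs_bound A B P (size Z).
Proof.
have [C1 H1] := rename_bound c; have [C2 H2] := search_bound.
have [C3 H3] := tables_bound.
eexists=> A B P Z r0 Zle; rewrite /main_cost /output_cost.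
have Y0 := bound_pos B r0 Zle.
apply: dom_add; first exact: dom_const.
apply: dom_add; first exact: dom_trans (H1 _) (bound_N _ r0 Zle).
apply: dom_add; first exact: H3.
apply: dom_add; first exact: dom_trans (H2 _ _ _ r0) (bound_nodes _ _ _ _).
apply: dom_add.
  by apply: dom_add; [apply: (dom_mul (bound_r _ r0 Zle) (leqnn _)) | apply: dom_const].
apply: dom_add; last exact: dom_const.
by apply: dom_add; [apply: (dom_mul (bound_m _ r0 Zle) (leqnn _)) | apply: dom_const].
Qed.

Lemma main_wf : wfS main. Proof. by []. Qed.

Theorem theorem1 :
  exists p : cmd, forall c : nat, exists C d : nat,
    forall A B P : seq nat,
      let N := size A + size B + size P in
      0 < size P ->
      (forall x, x \in A ++ B ++ P -> x < N.+1 ^ c) ->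
      exists Z : seq nat,
        str_ec_lcs A B P Z /\
        computes_within (N.+1 ^ d)
          (C * ec_lcs_bound A B P (size Z)) (C * ec_lcs_bound A B P (size Z))
          p A B P Z.
Proof.
exists program => c; have [C0 HC] := main_bound c.
have [C EC] : exists C, C = C0 + 200 by eexists.
exists C, (C + 4 + c) => A B P N r0 chars.
have [Z0 opt0] := str_ec_lcs_exists A B r0.
have Z0m : size Z0 <= size A by have [/and3P[/size_subseq]] := opt0.
pose b := ec_lcs_bound A B P (size Z0).
have b0 : 0 < b by exact: bound_pos.
have bN : N.+1 <= 4 * b by exact: bound_N.
pose W := N.+1 ^ (C + 4 + c).
have K2 : 2 <= N.+1 by rewrite /N; lia.
have bW : C * b <= W.
  rewrite /W !expnD; apply: (@leq_trans (N.+1 ^ C * N.+1 ^ 4)).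
    apply: leq_mul; last exact: bound_pow.
    apply: (@leq_trans (2 ^ C)); first by apply: ltnW; apply: ltn_expl.
    by rewrite leq_exp2r // EC addn_gt0 orbT.
  by rewrite leq_pmulr // expn_gt0.
have cW : N.+1 ^ c <= W by rewrite /W leq_exp2l // leq_addl.
have bW' : 200 * b <= W by apply: leq_trans bW; rewrite leq_mul2r EC leq_addl orbT.
have NW : N < W by apply: leq_trans bW'; lia.
have [t [s' [X le [Z [opt Em En Zm Hout]]]]] :
    runs N (8 * b) W main (start A B P) (main_cost c A B P Z0) (fun s' =>
      exists Z, [/\ str_ec_lcs A B P Z, hv s' rm = size Z, hv s' rn = 0,
        size Z <= size A & forall i, i < size Z -> ha s' raw i = nth 0 Z i]).
  apply: main_runs => //.
  - by rewrite -/N; lia.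
  - by apply: leq_trans (bound_nxt B r0 Z0m) _; rewrite leq_mul2r orbT.
  - by apply: leq_trans (bound_dfa B r0 Z0m) _; rewrite leq_mul2r orbT.
  - by have := bound_nodes A B P Z0; rewrite -/b; lia.
  - by lia.
have EZ : size Z = size Z0.
  apply/eqP; rewrite eqn_leq; apply/andP; split.
    by have [_ H] := opt0; apply: H; case: opt.
  by have [_ H] := opt; apply: H; case: opt0.
exists Z; split=> //; rewrite EZ -/b; set S := C * b.
have S_large : N + 16 * (8 * b) <= S by rewrite /S EC mulnDl; lia.
have sizes : size (A ++ B ++ P) = N by rewrite !size_cat addnA.
split; first by rewrite sizes; lia.
pose l0 := input_state A B P.
pose l1 := set_reg l0 regN (size A + size B).
pose l2 := set_reg l1 regN N.
have xW i : nth 0 (A ++ B ++ P) i < W.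
  case: (ltnP i (size (A ++ B ++ P))) => [lt|ge]; last by rewrite nth_default //; lia.
  by apply: leq_trans cW; apply: chars; apply: mem_nth.
have R : models N W l2 (start A B P).
  split=> //=.
  - by move=> x _; case: eqP.
  - by move=> a i lta; rewrite ltn_eqF // nth_default // sizes; lia.
  - split=> [x|i]; last exact: xW.
    apply: leq_ltn_trans NW; rewrite /N.
    by case: x => [|[|[|[|x]]]] /=; rewrite ?nth_nil; lia.
have [l' X' [Hr _ Hi _ _]] := compS_run S_large bW ltac:(lia) X main_wf R.
exists (1 + (1 + t)), l'; split.
- apply: (ExecSeq (s2 := l1)); first by apply: ExecOp; apply: leq_ltn_trans NW;
    rewrite /= /N; lia.
  apply: (ExecSeq (s2 := l2)) X'.
  have -> : l2 = set_reg l1 regN (eval_op Add (regs l1 regN) (regs l1 rr)) by [].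
  by apply: ExecOp; apply: leq_ltn_trans NW; rewrite /= /N; lia.
- by have := HC A B P Z0 r0 Z0m; rewrite -/b /S EC mulnDl; lia.
- split; rewrite !Hr // ?Em ?En //.
  + by rewrite EZ add0n; lia.
  + by move=> i lt; rewrite add0n Hi ?Hout // /N; lia.
Qed.
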